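(* Let $n\ge1$, $p>1$, $\alpha>0$, $s>1$ with $\alpha s\le n$, and $p'=p/(p-1)$. Then for every $f\in L^p_{\rm loc}(\mathbb{R}^n)$ $$\|f\|_{M^{\alpha,s}_p}=\sup_w\Big(\int_{\mathbb{R}^n}|f(x)|^p\,w(x)\,dx\Big)^{1/p},$$ where the supremum is taken over all weights $w$ such that $w$ is defined ${\rm Cap}_{\alpha,s}$-quasieverywhere and $\int_{\mathbb{R}^n}w\,dC\le1$. Moreover, $(\widetilde N^{\alpha,s}_{p'})^*=M^{\alpha,s}_p$ (isometrically isomorphic), where for $q>1$, $\widetilde N^{\alpha,s}_q$ is the space of all measurable functions $g$ such that $$\|g\|_{\widetilde N^{\alpha,s}_q}:=\inf_w\Big(\int_{\mathbb{R}^n}|g(x)|^q w(x)^{1-q}\,dx\Big)^{1/q}<+\infty,$$ the infimum being taken over all nonnegative q.e. defined functions $w\in L^1_{\rm loc}(\mathbb{R}^n)$ such that $\int_{\mathbb{R}^n}w\,dC\le1$.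
   Context: $G_\alpha=\mathcal{F}^{-1}[(1+|\xi|^2)^{-\alpha/2}]$ is the Bessel kernel of order $\alpha$ on $\mathbb{R}^n$. For $E\subset\mathbb{R}^n$ the Bessel capacity is ${\rm Cap}_{\alpha,s}(E)=\inf\{\|f\|_{L^s}^s: f\ge 0,\ G_\alpha*f\ge 1 \text{ on } E\}$. A function is defined quasieverywhere (q.e.) if it is defined outside a set of zero capacity ${\rm Cap}_{\alpha,s}$ (such sets have Lebesgue measure zero). For q.e. defined $w:\mathbb{R}^n\to[0,\infty]$ the Choquet integral is $\int_{\mathbb{R}^n} w\,dC=\int_0^\infty {\rm Cap}_{\alpha,s}(\{x: w(x)>t\})\,dt$. A weight is a nonnegative (Lebesgue measurable) function. For $p\ge1$, $M^{\alpha,s}_p$ is the space of $f\in L^p_{\rm loc}(\mathbb{R}^n)$ with finite norm $\|f\|_{M^{\alpha,s}_p}=\sup_K\big(\int_K|f|^p\,dx/{\rm Cap}_{\alpha,s}(K)\big)^{1/p}$, the supremum over all compact $K\subset\mathbb{R}^n$ with ${\rm Cap}_{\alpha,s}(K)\neq 0$. In $\int|g|^qw^{1-q}dx<\infty$ it is understood that $g=0$ a.e. on $\{w=0\}$ (the integrand being taken as $0$ where $g=0$). The dual of a quasinormed space is the space of bounded linear functionals with the operator norm. *)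

(* Defs.v *)
From HB Require Import structures.
From mathcomp Require Import all_boot all_order all_algebra.
From mathcomp Require Import complex.
From mathcomp Require Import all_classical all_reals all_analysis.
From mathcomp Require Import measurable_realfun.

Set Implicit Arguments.
Unset Strict Implicit.
Unset Printing Implicit Defensive.
Import Order.TTheory GRing.Theory Num.Theory.
Import numFieldNormedType.Exports.

Local Open Scope classical_set_scope.
Local Open Scope ring_scope.

Section lebesgue_outer_measure.
Context (R : realType) (n : nat).

(* The half-open box `\prod_i ]a_i, b_i]` is encoded by [Some (a, b)];
   [None] encodes the empty set, so that finite covers are allowed
   (and the empty set has outer measure zero even when n = 0). *)
Definition box (B : option ('rV[R]_n * 'rV[R]_n)) : set 'rV[R]_n :=
  if B is Some (a, b) then [set x | forall i, a 0 i < x 0 i <= b 0 i] else set0.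

Definition box_volume (B : option ('rV[R]_n * 'rV[R]_n)) : R :=
  if B is Some (a, b) then \prod_(i < n) Num.max 0 (b 0 i - a 0 i) else 0.

Local Open Scope ereal_scope.

Definition lebesgue_outer (A : set 'rV[R]_n) : \bar R :=
  ereal_inf [set \sum_(k <oo) (box_volume (B k))%:E
            | B in [set B | A `<=` \bigcup_k box (B k)]].

Let vol B := (box_volume B)%:E.

Let vol_ge0 B : 0 <= vol B.
Proof.
rewrite /vol lee_fin; case: B => [[a b]|//=].
by apply: prodr_ge0 => i _; rewrite le_max lexx.
Qed.

Lemma lebesgue_outer_ge0 A : 0 <= lebesgue_outer A.
Proof.
by apply: le_ereal_inf_tmp => x [B AB <-{x}]; apply: nneseries_ge0 => *; exact: vol_ge0.
Qed.

Lemma lebesgue_outer0 : lebesgue_outer set0 = 0.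
Proof.
apply/eqP; rewrite eq_le lebesgue_outer_ge0 andbT.
apply: ereal_inf_lbound; exists (fun=> None) => //=.
by rewrite eseries0.
Qed.

Lemma le_lebesgue_outer : {homo lebesgue_outer : A B / A `<=` B >-> A <= B}.
Proof.
move=> A B AB; apply/ereal_inf_le_tmp => x [C BC <-{x}].
by exists C => //; exact: subset_trans AB BC.
Qed.

Lemma lebesgue_outer_sigma_subadditive : sigma_subadditive lebesgue_outer.
Proof.
move=> A; have [[i ioo]|] := pselect (exists i, lebesgue_outer (A i) = +oo).
  rewrite (eseries_pinfty _ _ ioo) ?leey// => k _.
  by rewrite -ltNye (lt_le_trans _ (lebesgue_outer_ge0 _)).
rewrite -forallNE => Aoo.
suff add2e (e : {posnum R}) : lebesgue_outer (\bigcup_k A k) <=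
    \sum_(i <oo) lebesgue_outer (A i) + e%:num%:E.
  by apply/lee_addgt0Pr => _/posnumP[].
rewrite (le_trans _ (epsilon_trick _ _ _))//; last first.
  by move=> k; exact: lebesgue_outer_ge0.
pose P k (B : nat -> option ('rV[R]_n * 'rV[R]_n)) :=
  A k `<=` \bigcup_j box (B j) /\
  \sum_(j <oo) vol (B j) <= lebesgue_outer (A k) + (e%:num / (2 ^ k.+1)%:R)%:E.
have [C PC] : {C & forall k, P k (C k)}.
  apply: (@choice _ _ P) => k; rewrite /P /lebesgue_outer.
  set S := (X in ereal_inf X); move infS : (ereal_inf S) => iS.
  case: iS infS => [r Sr|Soo|Soo].
  - have en1 : (0 < e%:num / (2 ^ k.+1)%:R)%R by [].
    have /(lb_ereal_inf_adherent en1) : ereal_inf S \is a fin_num by rewrite Sr.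
    move=> [x [B AkB muBx] xS].
    by exists B; split => //; rewrite muBx -Sr; exact/ltW.
  - by have := Aoo k; rewrite /lebesgue_outer Soo.
  - suff : lbound S 0 by move/le_ereal_inf_tmp; rewrite Soo.
    by move=> /= _ [B AkB <-]; apply: nneseries_ge0 => *; exact: vol_ge0.
have volC_ge0 x : 0 <= (vol \o uncurry C) x by exact: vol_ge0.
apply: (@le_trans _ _ (\esum_(i in setT) (vol \o uncurry C) i)).
  apply: ereal_inf_lbound => /=.
  have /card_esym/ppcard_eqP[f] := card_nat2.
  exists (uncurry C \o f) => /=.
    apply: (@subset_trans _ (\bigcup_k \bigcup_j box (C k j))) => [t [i _]|].
      by move=> /((PC i).1) -[j _ ?]; exists i => //; exists j.
    move=> t [i _ [j _ Bijt]]; exists (f^-1%FUN (i, j)) => //=.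
    by rewrite invK ?inE.
  rewrite -(esum_pred_image (vol \o uncurry C) _ xpredT) ?[fun=> _]set_true//.
  by rewrite image_eq.
rewrite (_ : esum _ _ = \sum_(i <oo) \sum_(j <oo ) vol (C i j)); last first.
  pose J : nat -> set (nat * nat) := fun i => [set (i, j) | j in setT].
  rewrite (_ : setT = \bigcup_k J k); last first.
    by rewrite predeqE => -[a b]; split => // _; exists a => //; exists b.
  rewrite esum_bigcupT /=; last 2 first.
    - apply/trivIsetP => i j _ _ ij.
      rewrite predeqE => -[k m] /=; split => //= -[] [_] _ [<-{k} _].
      by move=> [m' _] [] /esym/eqP; rewrite (negbTE ij).
    - by move=> x; exact: volC_ge0.
  rewrite -(image_id [set: nat]) -fun_true esum_pred_image//; last first.
    by move=> k _; exact: esum_ge0.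
  apply: eq_eseriesr => /= j _.
  rewrite -(esum_pred_image (vol \o uncurry C) (pair j) predT)//=; last first.
    by move=> ? ? _ _; exact: (@can_inj _ _ _ snd).
  by congr esum; rewrite predeqE => -[a b]; split; move=> [i _ <-]; exists i.
apply: lee_lim.
- apply: is_cvg_nneseries => k *.
  by apply: nneseries_ge0 => m *; exact: (volC_ge0 (k, m)).
- by apply: is_cvg_nneseries => k *; apply: adde_ge0 => //; exact: lebesgue_outer_ge0.
- by near=> k; apply: lee_sum => i _; exact: (PC i).2.
Unshelve. all: by end_near. Qed.

HB.instance Definition _ := isOuterMeasure.Build R 'rV[R]_n lebesgue_outer
  lebesgue_outer0 lebesgue_outer_ge0 le_lebesgue_outer
  lebesgue_outer_sigma_subadditive.

End lebesgue_outer_measure.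

(* R^n with its usual topology, and with the sigma-algebra of all Lebesgue
   (not only Borel) measurable sets. *)
Definition Rn (R : realType) (n : nat) : Type := 'rV[R]_n.

HB.instance Definition _ (R : realType) (n : nat) :=
  NormedModule.copy (Rn R n) 'rV[R]_n.
HB.instance Definition _ (R : realType) (n : nat) :=
  Measurable.copy (Rn R n)
    (caratheodory_type (@lebesgue_outer R n : set 'rV[R]_n -> \bar R)).

Definition leb (R : realType) (n : nat) : set (Rn R n) -> \bar R :=
  @lebesgue_outer R n.

Lemma leb_sigma_additive (R : realType) (n : nat) :
  semi_sigma_additive (@leb R n).
Proof. exact: (@caratheodory_measure_sigma_additive R 'rV[R]_n (@lebesgue_outer R n)). Qed.

HB.instance Definition _ (R : realType) (n : nat) :=
  isMeasure.Build _ (Rn R n) R (@leb R n)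
    (@lebesgue_outer0 R n) (@lebesgue_outer_ge0 R n) (@leb_sigma_additive R n).

Section bessel_capacity.
Context (R : realType) (n : nat).
Local Notation mu := (@leb R n).
Implicit Types (f g G : Rn R n -> R) (x y xi : Rn R n) (w : Rn R n -> \bar R).
Implicit Types (E K D : set (Rn R n)) (alpha p q s : R).

Definition dot x y : R := \sum_(i < n) x 0 i * y 0 i.

(* \hat f(xi) = \int f(x) e^{- i x.xi} dx for an integrable real-valued f *)
Definition fourier f xi : R[i] :=
  Complex (\int[mu]_x (f x * cos (dot x xi)))
          (- \int[mu]_x (f x * sin (dot x xi))).

(* The inverse Fourier transform of (1 + |xi|^2)^(-alpha/2), which need not be
   integrable, is the integrable function whose Fourier transform it is; like
   any such function it is only determined up to a null set, so the Bessel
   kernels of order alpha are the representatives of one a.e.-class. *)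
Definition bessel_kernel alpha : set (Rn R n -> R) :=
  [set G : Rn R n -> R | mu.-integrable setT (EFin \o G) /\
           forall xi, fourier G xi = ((1 + dot xi xi) `^ (- (alpha / 2)))%:C%C].

Local Open Scope ereal_scope.

(* f >= 0: the integral is taken in [0, +oo] and is defined for every x, since
   a Bessel kernel is a.e. nonnegative; it only depends on the class of G *)
Definition convolution G f x : \bar R := \int[mu]_y (G (x - y)%R * f y)%:E.

Definition capacity G s E : \bar R :=
  ereal_inf [set 'N[mu]_(s%:E)[EFin \o f] `^ s | f in
    [set f : Rn R n -> R | [/\ measurable_fun setT f, forall x, (0 <= f x)%R &
                 forall x, E x -> 1 <= convolution G f x]]].

(* A function that is defined quasieverywhere is encoded by a total function w
   together with its domain D; the values of w outside of D are never used. *)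
Definition choquet G s D w : \bar R :=
  \int[lebesgue_measure]_(t in `]0%R, +oo[)
    capacity G s [set x | D x /\ t%:E < w x].

(* D is Lebesgue measurable, since its complement has zero capacity *)
Definition qe_weight G s D w : Prop :=
  [/\ capacity G s (~` D) = 0, measurable_fun D w & forall x, D x -> 0 <= w x].

Definition Lp_loc p : set (Rn R n -> R) :=
  [set f : Rn R n -> R | measurable_fun setT f /\
    forall K, compact K -> \int[mu]_(x in K) (`|f x| `^ p)%:E < +oo].

Definition normM G s p f : \bar R :=
  ereal_sup [set ((\int[mu]_(x in K) (`|f x| `^ p)%:E) / capacity G s K) `^ p^-1
            | K in [set K : set (Rn R n) | compact K /\ capacity G s K != 0]].

Definition spaceM G s p : set (Rn R n -> R) :=
  [set f : Rn R n -> R | Lp_loc p f /\ normM G s p f < +oo].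

Definition L1_loc_on D w : Prop :=
  measurable_fun D w /\
  forall K, compact K -> \int[mu]_(x in D `&` K) `|w x| < +oo.

(* w^(1-q) is written as (w^(q-1))^-1 because 0 `^ (1 - q) = 0 in the library,
   whereas 0^-1 = +oo and +oo^-1 = 0 for extended reals; moreover 0 * +oo = 0,
   so that the integrand is 0 where g = 0 and +oo where g != 0 and w = 0. *)
Definition normN G s q g : \bar R :=
  ereal_inf [set (\int[mu]_(x in Dw.1)
                    ((`|g x| `^ q)%:E * (Dw.2 x `^ (q - 1))^-1)) `^ q^-1
            | Dw in [set Dw : set (Rn R n) * (Rn R n -> \bar R) |
                      [/\ qe_weight G s Dw.1 Dw.2, L1_loc_on Dw.1 Dw.2 &
                          choquet G s Dw.1 Dw.2 <= 1]]].

Definition spaceN G s q : set (Rn R n -> R) :=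
  [set g : Rn R n -> R | measurable_fun setT g /\ normN G s q g < +oo].

Definition sup_weighted G s p f : \bar R :=
  ereal_sup [set (\int[mu]_(x in Dw.1) ((`|f x| `^ p)%:E * Dw.2 x)) `^ p^-1
            | Dw in [set Dw : set (Rn R n) * (Rn R n -> \bar R) |
                      qe_weight G s Dw.1 Dw.2 /\ choquet G s Dw.1 Dw.2 <= 1]].

Definition pairing f g : R := (\int[mu]_x (f x * g x))%R.

End bessel_capacity.

Section dual_space.
Context (R : realType) (T : Type).
Local Open Scope ereal_scope.

(* A quasinormed function space is given by the set X of its members and by
   its quasinorm N on X; the values of a functional outside of X are irrelevant.
   Functions with N (g - h) = 0 are not distinguished by bounded functionals. *)
Implicit Types (X Y : set (T -> R)) (N : (T -> R) -> \bar R).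
Implicit Types (L : (T -> R) -> R) (J : (T -> R) -> (T -> R) -> R).

Definition dual X N : set ((T -> R) -> R) :=
  [set L : (T -> R) -> R | (forall (a : R) g h, X g -> X h ->
             L (fun x => a * g x + h x)%R = (a * L g + L h)%R) /\
           exists C : R, forall g, X g -> `|L g|%:E <= C%:E * N g].

Definition opnorm X N L : \bar R :=
  ereal_sup [set `|L g|%:E | g in [set g : T -> R | X g /\ N g <= 1]].

(* J is an isometric isomorphism of Y, with norm M and equality eqY, onto the
   dual of X *)
Definition isometric_iso_to_dual X N Y M (eqY : (T -> R) -> (T -> R) -> Prop)
    J : Prop :=
  [/\ forall f, Y f -> dual X N (J f),
      forall f, Y f -> opnorm X N (J f) = M f,
      forall (a : R) f1 f2 g, Y f1 -> Y f2 -> X g ->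
        J (fun x => a * f1 x + f2 x)%R g = (a * J f1 g + J f2 g)%R,
      forall f1 f2, Y f1 -> Y f2 ->
        (forall g, X g -> J f1 g = J f2 g) -> eqY f1 f2 &
      forall L, dual X N L -> exists2 f, Y f & forall g, X g -> J f g = L g].

End dual_space.

(* Main.v *)
Require Import Defs.
From HB Require Import structures.
From mathcomp Require Import all_boot all_order all_algebra.
From mathcomp Require Import all_classical all_reals all_analysis.
From mathcomp Require Import measurable_realfun.
From mathcomp Require Import lra ring.

Import Order.TTheory GRing.Theory Num.Theory.
Import numFieldNormedType.Exports.

Local Open Scope classical_set_scope.
Local Open Scope ring_scope.

(* The kernel G enters through two facts: it is integrable, and its integral is 1
   (the Fourier transform at 0).  The second makes compact sets have finite
   capacity, since G * (2 1_Q) >= 1 on K for a large cube Q; the first gives a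
   weak-type bound for |G| * f, which makes sets of zero capacity Lebesgue null.

   If M = ||f||_M^p then \int_E |f|^p <= M Cap(E) for compact E by definition and
   for measurable E by inner regularity.  Integrating this over the level sets
   {w > t} gives \int |f|^p w <= M \int w dC, whereas w = 1_K / Cap(K) recovers
   the quotient defining the norm; this is the first formula.

   The pairing is bounded by Hoelder's inequality for |f| w^(1/p) and
   |g| w^(-1/p), and g = sgn(f) |f|^(p-1) 1_K is extremal in it up to the choice
   of K.  Conversely, a bounded functional L on N restricts, for each K, to a
   bounded functional on L^p'(K), because w = 1_K / Cap(K) is an admissible
   weight; so it has a density by the Radon-Nikodym theorem.  The densities glue
   to a function f, the same extremal g bounds the M-norm of f by that of L, and
   truncated functions are dense in N. *)

(** * Lebesgue measure on R^n *)

(** Two obstacles shape the proof. Capacity is a badly behaved set function, so after the two kernel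
    estimates everything takes place over an abstract [capacity_space], where [cap] is essentially
    only monotone, finite on compact sets and zero only on null sets; neither subadditivity nor
    continuity of [capacity] enters. The second obstacle is circularity in the converse direction:
    the extremal function built from the density f lies in the space N only if f is locally in L^p,
    which is what it should prove. It is therefore first cut to sets where f is bounded, where its
    pairing with f is finite and can be divided out, and the cut is removed by monotone convergence.
    Weights may take the values 0 and +oo, so Hoelder's inequality is obtained by integrating a
    pointwise Young inequality in which these values are treated separately. *)

Section lebesgue_measure_Rn.
Context {R : realType} {n : nat}.
Local Notation T := (Rn R n).
Local Notation mu := (@leb R n).
Implicit Types (A E K U : set T) (i : 'I_n) (c : R).

Let box_low i c (B : option (T * T)) : option (T * T) :=
  if B is Some (a, b) then
    Some (a, \row_j (if j == i then Num.min (b 0 i) c else b 0 j)) else None.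

Let box_high i c (B : option (T * T)) : option (T * T) :=
  if B is Some (a, b) then
    Some (\row_j (if j == i then Num.max (a 0 i) c else a 0 j), b) else None.

Let box_split i c (B : option (T * T)) :
  box_volume (box_low i c B) + box_volume (box_high i c B) <= box_volume B.
Proof.
case: B => [[a b]|] /=; last by rewrite addr0.
rewrite (bigD1 i)//= (bigD1 i (P := predT))//= [leRHS](bigD1 i)//= !mxE eqxx.
rewrite (eq_bigr (fun j => Num.max 0 (b 0 j - a 0 j))); last first.
  by move=> j /negbTE ji; rewrite !mxE ji.
rewrite [X in _ + _ * X](eq_bigr (fun j => Num.max 0 (b 0 j - a 0 j))); last first.
  by move=> j /negbTE ji; rewrite !mxE ji.
rewrite -mulrDl; apply: ler_wpM2r.
  by apply: prodr_ge0 => j _; rewrite le_max lexx.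
rewrite /Num.max /Num.min; repeat (case: ifP); lra.
Qed.

Lemma box_volume_ge0 (B : option (T * T)) : 0 <= box_volume B.
Proof.
case: B => [[a b]|//=].
by apply: prodr_ge0 => j _; rewrite le_max lexx.
Qed.

Lemma lebesgue_outer_le A (B : nat -> option (T * T)) :
  A `<=` \bigcup_k box (B k) ->
  (mu A <= \sum_(k <oo) (box_volume (B k))%:E)%E.
Proof. by move=> AB; apply: ereal_inf_lbound; exists B. Qed.

(* A hyperplane cuts each box of a cover into two boxes whose volumes add up to
   the volume of the box. *)
Lemma measurable_halfspace i c : measurable [set x : T | x 0 i <= c].
Proof.
apply: le_caratheodory_measurable => X.
apply: le_ereal_inf_tmp => _ [B XB <-].
set V := [set x : T | _].
apply: (@le_trans _ _ (\sum_(k <oo) (box_volume (box_low i c (B k)))%:E +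
   \sum_(k <oo) (box_volume (box_high i c (B k)))%:E)%E).
  apply: leeD; apply: lebesgue_outer_le => x [Xx Vx]; have [k _ Bx] := XB _ Xx;
    exists k => //; move: Bx; case: (B k) => [[a b]|//] /= Bx j; rewrite mxE.
  - by case: eqP => [->|_]; rewrite ?le_min //; case/andP: (Bx i) => -> -> /=.
  - case: eqP => [->|_] //; rewrite gt_max; case/andP: (Bx i) => -> -> /=.
    by rewrite andbT ltNge; apply/negP.
rewrite -nneseriesD; [|by move=> k _; rewrite lee_fin box_volume_ge0..].
apply: lee_nneseries => k _.
  by move=> _; rewrite adde_ge0 ?lee_fin ?box_volume_ge0.
by rewrite -EFinD lee_fin box_split.
Qed.

Lemma measurable_coord i : measurable_fun setT (fun x : T => x 0 i).
Proof.
apply: (measurability _ (RGenOInfty.measurableE R)).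
move=> _ [_ [c ->] <-]; rewrite setTI.
rewrite (_ : _ @^-1` _ = ~` [set x : T | x 0 i <= c]).
  exact/measurableC/measurable_halfspace.
by apply/seteqP; split => x /=; rewrite in_itv/= andbT ltNge => /negP.
Qed.

Lemma measurable_box (B : option (T * T)) : measurable (box B : set T).
Proof.
case: B => [[a b]|/=]; last exact: measurable0.
rewrite (_ : box _ = \bigcap_(i in [set: 'I_n])
   ((fun x : T => x 0 i) @^-1` `]a 0 i, b 0 i])).
  apply: fin_bigcap_measurable => [|i _]; first exact: finite_finset.
  by rewrite -[X in measurable X]setTI; apply: measurable_coord.
apply/seteqP; split => x /= h i; first by move=> _ /=; rewrite in_itv/=.
by have := h i I; rewrite /= in_itv.
Qed.

Definition cube (r : R) : set T := [set x | forall i, `|x 0 i| <= r].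

Lemma cubeE r : cube r = \bigcap_(i in [set: 'I_n])
   ((fun x : T => x 0 i) @^-1` `[- r, r]).
Proof.
apply/seteqP; split => x /= h i.
  by move=> _ /=; rewrite in_itv/= -ler_norml; exact: h.
by have := h i I; rewrite /= in_itv /= -ler_norml.
Qed.

Lemma measurable_cube r : measurable (cube r).
Proof.
rewrite cubeE; apply: fin_bigcap_measurable => [|i _]; first exact: finite_finset.
by rewrite -[X in measurable X]setTI; apply: measurable_coord.
Qed.

Lemma compact_cube r : compact (cube r).
Proof.
have := @rV_compact R n (fun=> `[- r, r]%classic) (fun=> @segment_compact R _ _).
congr compact; apply/seteqP; split => x /= h i; have := h i;
  by rewrite in_itv /= -ler_norml.
Qed.

Lemma leb_box (B : option (T * T)) : (mu (box B) <= (box_volume B)%:E)%E.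
Proof.
have := @lebesgue_outer_le (box B) (fun k => if k is 0%N then B else None).
rewrite nneseries_recl//; last by case=> *; rewrite lee_fin ?box_volume_ge0 /=.
rewrite eseries0 ?adde0; last by case.
by apply => x Bx; exists 0%N.
Qed.

Lemma leb_cube_lty r : (mu (cube r) < +oo)%E.
Proof.
(* Boxes are open on the left, so the lower corner is moved from -r to -r - 1 to catch the faces x_i
   = -r. *)
apply: (@le_lt_trans _ _ (mu (box (Some (const_mx (- r - 1) : T, const_mx r : T))))).
  apply: le_outer_measure => x rx i; rewrite !mxE.
  by have := rx i; rewrite ler_norml => /andP[]; lra.
by apply: le_lt_trans (leb_box _) _; rewrite ltry.
Qed.

Lemma cube_exhaust : \bigcup_k cube k%:R = [set: T].
Proof.
apply/seteqP; split => // x _.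
exists (Num.truncn (\sum_i `|x 0 i|)).+1 => // i.
apply: ltW; apply: le_lt_trans (_ : _ <= \sum_i `|x 0 i|) _.
  by rewrite (bigD1 i)//= lerDl sumr_ge0.
by rewrite truncnS_gt.
Qed.

Lemma subset_cube r r' : r <= r' -> cube r `<=` cube r'.
Proof. by move=> rr' x rx i; exact: le_trans (rx i) rr'. Qed.

Lemma leb_sigma_finite : sigma_finite setT mu.
Proof.
exists (fun k => cube k%:R); first by rewrite cube_exhaust.
by move=> k; split; [exact: measurable_cube|exact: leb_cube_lty].
Qed.

End lebesgue_measure_Rn.

HB.instance Definition _ (R : realType) (n : nat) :=
  Measure_isSigmaFinite.Build _ _ R (@leb R n) (@leb_sigma_finite R n).

Lemma ge0_integral_measure_preserving d (T : measurableType d) (R : realType)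
    (mu : {measure set T -> \bar R}) (phi : T -> T) (f : T -> \bar R) :
  measurable_fun setT phi -> (forall A, measurable A -> mu (phi @^-1` A) = mu A) ->
  measurable_fun setT f -> (forall x, 0 <= f x)%E ->
  (\int[mu]_x f (phi x) = \int[mu]_x f x)%E.
Proof.
move=> mphi muphi mf f0.
rewrite -[LHS]/(\int[mu]_(y in phi @^-1` setT) (f \o phi) y)%E.
rewrite -(ge0_integral_pushforward mphi)//.
by apply: eq_measure_integral => A mA _; exact: muphi.
Qed.

(** * Reflection invariance, regularity and completeness of Lebesgue measure *)

Section lebesgue_measure_Rn_regularity.
Context {R : realType} {n : nat}.
Local Notation T := (Rn R n).
Local Notation mu := (@leb R n).
Implicit Types (A E K U : set T) (i : 'I_n) (c : T).

Let enlarge (d : R) (B : option (T * T)) : option (T * T) :=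
  if B is Some (a, b) then Some (a - const_mx d, b + const_mx d) else None.

(** The volume of the enlarged box is continuous in d at 0. *)
Let enlarge_volume (B : option (T * T)) (e : R) : 0 < e ->
  exists2 d, 0 < d & box_volume (enlarge d B) <= box_volume B + e.
Proof.
case: B => [[a b]|] e0 /=; last by exists 1 => //; rewrite add0r ltW.
have : (\prod_(i < n) Num.max 0 ((b + const_mx d) 0 i - (a - const_mx d) 0 i)) @[d --> (0
  : R)] -->
   \prod_(i < n) Num.max 0 ((b + const_mx 0) 0 i - (a - const_mx 0) 0 i).
  apply: cvg_big => [|i _ ]; first exact: mul_continuous.
  under eq_fun do rewrite !mxE.
  rewrite !mxE.
  apply: (@continuous_max R R (fun=> 0) (fun d => b 0 i + d - (a 0 i - d))).
    exact: cvg_cst.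
  apply: continuousB; apply: continuousD => //; first exact: cvg_cst.
    exact: cvg_cst.
  by apply: continuousN.
move=> /cvgrPdist_lt /(_ _ e0) /nbhs_ballP [d /= d0 H].
exists (d / 2); first by rewrite divr_gt0.
have := H (d / 2); rewrite /ball /= sub0r normrN gtr0_norm ?divr_gt0 //.
rewrite ltr_pdivrMr // ltr_pMr // ltrDl ltr01 => /(_ isT).
rewrite ltr_norml => /andP[+ _].
rewrite [X in _ < X - _](eq_bigr (fun i => Num.max 0 (b 0 i - a 0 i))).
  by rewrite ltrBrDl ltrBlDr => /ltW.
by move=> i _; rewrite !mxE addr0 subr0.
Qed.

(** Every point of a box has distance at least d k from the complement of the enlarged box. This
    room turns covers by half-open boxes into open covers, and into covers of reflected sets. Half
    of e pays for a nearly optimal cover, half for the enlargements. *)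
Lemma outer_box_enlarge A (e : R) : 0 < e -> (mu A < +oo)%E ->
  exists B : nat -> option (T * T), exists d : nat -> R,
  [/\ forall k, 0 < d k, A `<=` \bigcup_k box (B k) &
   (\sum_(k <oo) (box_volume (enlarge (d k) (B k)))%:E <= mu A + e%:E)%E].
Proof.
move=> e0 Aoo.
have muA : mu A \is a fin_num by rewrite ge0_fin_numE.
have e20 : 0 < e / 2 by rewrite divr_gt0.
have [_ [B AB <-] Blt] := lb_ereal_inf_adherent e20 muA.
have /choice[d dP] : forall k, exists d, 0 < d /\ box_volume (enlarge d (B k)) <=
    box_volume (B k) + e / 2 / (2 ^ k.+1)%:R.
  move=> k; have [|d d0 dB] := @enlarge_volume (B k) (e / 2 / (2 ^ k.+1)%:R).
    by rewrite !divr_gt0// ltr0n expn_gt0.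
  by exists d.
exists B, d; split => //; first by move=> k; exact: (dP k).1.
apply: le_trans (_ : _ <= \sum_(k <oo) ((box_volume (B k))%:E + (e / 2 / (2 ^
  k.+1)%:R)%:E))%E _.
  apply: lee_nneseries => [k _|k _]; first by rewrite lee_fin box_volume_ge0.
  by rewrite -EFinD lee_fin; exact: (dP k).2.
apply: le_trans (epsilon_trick _ _ _) _.
- by move=> k; rewrite lee_fin box_volume_ge0.
- exact: ltW.
rewrite [e in leRHS](splitr e) EFinD addeA leeD2r //.
exact: ltW.
Qed.

(** A reflected box is open on the right instead of the left, hence not a box; the reflection of the
    enlarged box contains it even after its faces are exchanged. *)
Lemma leb_reflection_le c A : (mu ((fun y => c - y)%R @^-1` A) <= mu A)%E.
Proof.
have [Aoo|] := ltP (mu A) +oo%E; last by rewrite leye_eq => /eqP ->; rewrite leey.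
apply/lee_addgt0Pr => e e0.
have [B [d [d0 AB dB]]] := outer_box_enlarge A e e0 Aoo.
apply: le_trans dB.
pose B' k := if B k is Some (a, b) then
  Some (c - (b + const_mx (d k)), c - (a - const_mx (d k))) else None.
apply: (@le_trans _ _ (\sum_(k <oo) (box_volume (B' k : option (T * T)))%:E)%E).
  apply: lebesgue_outer_le => y /= /AB [k _ Bk]; exists k => //.
  rewrite /B'; case: (B k) Bk => [[a b]|//] /= Bk i.
  have := Bk i; have := d0 k; rewrite !mxE => ? /andP[? ?].
  by apply/andP; split; lra.
rewrite le_eqVlt; apply/orP; left; apply/eqP; apply: eq_eseriesr => k _.
congr EFin; rewrite /B'; case: (B k) => [[a b]|//] /=.
by apply: eq_bigr => i _; rewrite !mxE; congr Num.max; ring.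
Qed.

Lemma leb_reflection c A : mu ((fun y => c - y) @^-1` A) = mu A.
Proof.
apply/eqP; rewrite eq_le leb_reflection_le /=.
rewrite [X in (mu X <= _)%E](_ : A = (fun y => c - y) @^-1` ((fun y => c - y) @^-1` A)).
  exact: leb_reflection_le.
by apply/seteqP; split => x /=; rewrite opprB addrC subrK.
Qed.

(** Since [leb_reflection] holds for arbitrary sets, the Caratheodory condition for the preimage of
    A, tested on X, is that of A tested on the reflection of X. *)
Lemma measurable_reflection c : measurable_fun setT (fun y : T => c - y).
Proof.
move=> _ A mA; rewrite setTI; apply: le_caratheodory_measurable => X.
set phi := fun y : T => c - y.
have phiK : involutive phi by move=> x; rewrite /phi opprB addrC subrK.
have phiI B : X `&` phi @^-1` B = phi @^-1` (phi @^-1` X `&` B).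
  by apply/seteqP; split => x /=; rewrite phiK.
rewrite preimage_setC !phiI -[leLHS]/(mu _ + mu _)%E !leb_reflection
  -[leRHS](leb_reflection c X).
by rewrite le_eqVlt; apply/orP; left; apply/eqP; exact: esym (mA _).
Qed.

Lemma ge0_integral_reflection c (f : T -> \bar R) : measurable_fun setT f ->
  (forall x, 0 <= f x)%E ->
  (\int[mu]_y f (c - y)%R = \int[mu]_y f y)%E.
Proof.
move=> mf f0.
exact: (@ge0_integral_measure_preserving _ _ _ mu (fun y => c - y) f
  (measurable_reflection c) (fun A _ => leb_reflection c A) mf f0).
Qed.

Lemma measurable_open U : open U -> measurable U.
Proof.
move=> oU.
(* Boxes with rational centre and rational half-width form a countable family. *)
pose b (qr : 'rV[rat]_n * rat) : option (T * T) :=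
  Some (map_mx ratr qr.1 - const_mx (ratr qr.2), map_mx ratr qr.1 + const_mx (ratr qr.2)).
rewrite (_ : U = \bigcup_(qr in [set qr | box (b qr) `<=` U]) box (b qr)).
  rewrite bigcup_mkcond; apply: countable_bigcupT_measurable => // qr.
  by case: ifP => _; [exact: measurable_box|exact: measurable0].
apply/seteqP; split => [x Ux|x [qr]]; last by move=> /[apply].
have /nbhs_ballP[d /= d0 xdU] : nbhs x U by exact: open_nbhs_nbhs.
(* Two points of a box of half-width q differ by less than 2q < d in each coordinate. *)
have [q] : exists q : rat, ratr q \in `]0, d / 2[.
  by have [q] := @rat_in_itvoo R 0 (d / 2) (divr_gt0 d0 (ltr0Sn _ _)); exists q.
rewrite in_itv/= => /andP[q0 qd].
have /choice[r rP] : forall i, exists r : rat, ratr r \in `](x 0 i - ratr q), (x 0 i + ratr q)[.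
  move=> i; have [|r] := @rat_in_itvoo R (x 0 i - ratr q) (x 0 i + ratr q).
    by lra.
  by exists r.
exists (\row_i r i, q) => /=.
  move=> y yB; apply: xdU; split => // i j; rewrite ord1.
  have := yB j; have := rP j; rewrite !mxE in_itv/= => /andP[? ?] /andP[? ?].
  rewrite /ball/= ltr_norml; apply/andP; split; lra.
move=> i; have := rP i; rewrite !mxE in_itv/= => /andP[? ?]; apply/andP; split; lra.
Qed.

(** The interiors of the enlarged boxes still cover A. *)
Lemma outer_regular A (e : R) : 0 < e -> (mu A < +oo)%E ->
  exists U, [/\ open U, A `<=` U & (mu U <= mu A + e%:E)%E].
Proof.
move=> e0 Aoo; have [B [d [d0 AB dB]]] := outer_box_enlarge A e e0 Aoo.
exists (\bigcup_k interior (box (enlarge (d k) (B k)) : set T)); split.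
- by apply: bigcup_open => k _; exact: open_interior.
- move=> x /AB[k _ Bx]; exists k => //; apply/nbhs_ballP; exists (d k) => //=.
  move=> y [_ xy]; case: (B k) Bx => [[a b]|//] /= Bx i.
  have := Bx i; have := xy 0 i; rewrite /ball /= ltr_norml !mxE => /andP[? ?] /andP[? ?].
  apply/andP; split; lra.
- apply: le_trans dB; apply: lebesgue_outer_le => x [k _ xk]; exists k => //.
  exact: interior_subset xk.
Qed.

Lemma measurable_closed K : closed K -> measurable K.
Proof. by move=> /closed_openC/measurable_open/measurableC; rewrite setCK. Qed.

Lemma measurable_compact K : compact K -> measurable K.
Proof.
move=> cK; apply: measurable_closed.
exact: (compact_closed (@norm_hausdorff R T) cK).
Qed.

Lemma compact_sub_cube K : compact K -> exists r : R, 0 < r /\ K `<=` cube r.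
Proof.
move=> /compact_bounded[M [Mr MK]].
exists (`|M| + 1); split; first by rewrite ltr_wpDl.
move=> x Kx i.
have := MK (`|M| + 1) _ x Kx; rewrite (le_lt_trans (ler_norm _)) ?ltrDl // => /(_ isT).
apply: le_trans.
rewrite [leRHS]/Num.norm /= mx_normrE; apply/bigmax_geP; right => /=; exists (0, i) => //.
Qed.

Lemma leb_compact_lty K : compact K -> (mu K < +oo)%E.
Proof.
move=> /compact_sub_cube[r [_ Kr]].
by apply: le_lt_trans (leb_cube_lty r); exact: le_outer_measure.
Qed.

(** If U is open and covers the complement of E in a cube with small excess, then the cube minus U
    is compact, and the part of E that it misses lies in this excess. *)
Lemma inner_regular E (e : R) : 0 < e -> measurable E -> (exists r, E `<=` cube r) ->
  exists K, [/\ compact K, K `<=` E & (mu (E `\` K) <= e%:E)%E].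
Proof.
move=> e0 mE [r Er].
have mQE : measurable (cube r `\` E) by apply: measurableD => //; exact: measurable_cube.
have QEoo : (mu (cube r `\` E) < +oo)%E.
  by apply: le_lt_trans (leb_cube_lty r); apply: le_outer_measure; exact: subDsetl.
have [U [oU QEU Ule]] := @outer_regular (cube r `\` E) e e0 QEoo.
exists (cube r `\` U); split.
- apply: (subclosed_compact _ (compact_cube r)); last exact: subDsetl.
  rewrite setDE; apply: closedI; last exact: open_closedC.
  exact: (compact_closed (@norm_hausdorff R T) (compact_cube r)).
- move=> x [rx Ux]; apply: contrapT => nEx; apply: Ux; exact: QEU.
- apply: (@le_trans _ _ (mu (U `\` (cube r `\` E)))).
    apply: le_outer_measure => x [Ex nK]; split; last by case.
    by apply: contrapT => nU; apply: nK; split => //; exact: Er.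
  have mU : measurable U by exact: measurable_open.
  rewrite measureD //=; last by apply: le_lt_trans Ule _; rewrite lte_add_pinfty ?ltry.
  rewrite leeBlDr ?ge0_fin_numE //; last first.
    by apply: le_lt_trans QEoo; apply: le_outer_measure; exact: subIsetr.
  apply: le_trans Ule _; rewrite addeC leeD2l //; apply: le_outer_measure.
  by move=> x QEx; split => //; exact: QEU.
Qed.

(** Intersect countable covers by boxes whose measures exceed that of A by at most 1/(k+1). Unlike a
    Lebesgue set, the hull lies in the sigma-algebra generated by the boxes, which is compatible
    with subtraction on the product space. *)
Lemma box_hull A : exists H : set T, [/\ <<s range (@box R n) >> H, A `<=` H & mu H = mu A].
Proof.
have [Aoo|] := ltP (mu A) +oo%E; last first.
  rewrite leye_eq => /eqP Aoo; exists setT; split => //.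
    exact: (@measurableT _ (g_sigma_algebraType (range (@box R n)))).
  by apply/eqP; rewrite Aoo eq_le leey /= -Aoo; exact: le_outer_measure.
have /choice[B BP] : forall k : nat, exists B : nat -> option (T * T),
   A `<=` \bigcup_j box (B j) /\
   (mu (\bigcup_j box (B j)) <= mu A + (k.+1%:R^-1)%:E)%E.
  move=> k; have k0 : 0 < (k.+1%:R^-1 : R) by rewrite invr_gt0 ltr0n.
  have [|_ [B AB <-] Blt] := lb_ereal_inf_adherent k0 (_ : mu A \is a fin_num).
    by rewrite ge0_fin_numE.
  exists B; split => //; apply: le_trans (ltW Blt); exact: lebesgue_outer_le.
exists (\bigcap_k \bigcup_j box (B k j)); split.
- apply: (@bigcapT_measurable _ (g_sigma_algebraType (range (@box R n)))) => k.
  apply: (@bigcupT_measurable _ (g_sigma_algebraType (range (@box R n)))) => j.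
  by apply: sub_sigma_algebra; exists (B k j).
- by move=> x Ax k _; exact: (BP k).1.
apply/eqP; rewrite eq_le; apply/andP; split; last first.
  by apply: le_outer_measure => x Ax k _; exact: (BP k).1.
apply/lee_addgt0Pr => e e0.
have [k ke] : exists k : nat, k.+1%:R^-1 < e.
  by have [k /=] := ltr_add_invr e0; rewrite add0r; exists k.
apply: le_trans (_ : _ <= mu A + (k.+1%:R^-1)%:E)%E _; last first.
  by rewrite leeD2l // lee_fin ltW.
apply: le_trans (BP k).2; apply: le_outer_measure; exact: bigcap_inf.
Qed.

Lemma box_hull_measurable (H : set T) : <<s range (@box R n) >> H -> measurable H.
Proof.
move: H; apply: smallest_sub; first exact: (@sigma_algebra_measurable _ T).
by move=> _ [B _ <-]; exact: measurable_box.
Qed.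

Lemma leb_null_measurable E : mu E = 0%E -> measurable E.
Proof.
move=> E0; have [H [mH EH HE]] := box_hull E.
apply: (@measure_is_complete_caratheodory R 'rV[R]_n (@lebesgue_outer R n)).
exists H; split => //; first exact: box_hull_measurable.
by rewrite -E0 -HE.
Qed.

End lebesgue_measure_Rn_regularity.

(* The function |G (x - y)| need not be measurable for the product of two Lebesgue
   sigma-algebras.  A majorant of |G| that is measurable for the sigma-algebra S of
   Borel sets and has the same integral makes Fubini's theorem applicable. *)
Lemma hull_majorant d (T : measurableType d) (R : realType)
    (mu : {measure set T -> \bar R}) (S : set (set T)) (g : T -> \bar R) :
  sigma_algebra setT S -> S `<=` measurable ->
  (forall A, measurable A -> exists H, [/\ S H, A `<=` H & mu H = mu A]) ->
  measurable_fun setT g -> (forall x, 0 <= g x)%E -> (\int[mu]_x g x < +oo)%E ->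
  exists H : T -> \bar R, [/\ forall x, (g x <= H x)%E,
    forall r : R, S [set x | (r%:E < H x)%E] &
    (\int[mu]_x H x = \int[mu]_x g x)%E].
Proof.
move=> [S0 SC SU] SM hull mg g0 goo.
have ST : S setT by rewrite -(setD0 setT); exact: SC.
have mgt (q : R) : measurable [set x | (q%:E < g x)%E].
  by rewrite -[X in measurable X]setTI; exact: emeasurable_fun_o_infty.
have /choice[B BP] : forall q : rat, exists B : set T, [/\ S B,
    [set x | ((ratr q : R)%:E < g x)%E] `<=` B &
    mu B = mu [set x | ((ratr q : R)%:E < g x)%E]].
  by move=> q; exact: hull.
(* H is the supremum over rational q of max(0, q) on the hull of {q < g}: a countable supremum of
   functions measurable for S. *)
pose h (q : rat) x : \bar R := if x \in B q then (Num.max 0 (ratr q : R))%:E else 0%E.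
pose H x := ereal_sup [set h q x | q in setT].
have hH q x : (h q x <= H x)%E by apply: ereal_sup_ubound; exists q.
have H0 x : (0 <= H x)%E.
  apply: le_trans (hH 0 x); rewrite /h; case: ifP => // _.
  by rewrite lee_fin le_max lexx.
have SH r : S [set x | (r%:E < H x)%E].
  rewrite (_ : [set x | _] = \bigcup_(q in [set: rat]) [set x | (r%:E < h q x)%E]).
    have SU' (F : rat -> set T) : (forall q, S (F q)) -> S (\bigcup_q F q).
      move=> SF; have := @SU (fun k => if (unpickle k : option rat) is Some q then F q
        else set0).
      rewrite (_ : \bigcup_k _ = \bigcup_q F q); first by apply => k; case: unpickle.
      apply/seteqP; split => [x [k _]|x [q _ Fx]].
        by case: unpickle => // q Fx; exists q.
      by exists (pickle q); [|rewrite pickleK].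
    apply: SU' => q; have [r0|r0] := ltP r 0.
      rewrite (_ : [set _ | _] = setT)//; apply/seteqP; split => // x _ /=.
      by rewrite /h; case: ifP => _; rewrite lte_fin ?lt_max ?r0.
    have [rq|qr] := ltP r (ratr q : R).
      rewrite (_ : [set _ | _] = B q); first by have [] := BP q.
      apply/seteqP; split => x /=; rewrite /h;
        first by case: ifPn => [/set_mem|_ /lt_geF] //; rewrite lee_fin r0.
      by move=> /mem_set ->; rewrite lte_fin lt_max rq orbT.
    rewrite (_ : [set _ | _] = set0)//; apply/seteqP; split => // x /=.
    by rewrite /h; case: ifP => _; rewrite ltNge lee_fin ?ge_max ?r0 ?qr.
  apply/seteqP; split => [x /= /ereal_sup_gt[_ [q _ <-] rq]|x [q _ /= rq]].
    by exists q.
  exact: lt_le_trans (hH q x).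
have gH x : (g x <= H x)%E.
  rewrite leNgt; apply/negP => Hg.
  have Hfin : H x \is a fin_num by rewrite ge0_fin_numE// (lt_le_trans Hg) ?leey.
  (* A rational q between H x and g x would put x into B q, where H is at least q. *)
  have [q Hq qg] : exists2 q : rat, (H x < (ratr q : R)%:E)%E & ((ratr q : R)%:E < g x)%E.
    move: Hg; rewrite -(fineK Hfin); case: (g x) => [r||] //.
      rewrite lte_fin => /rat_in_itvoo[q]; rewrite in_itv/= => /andP[? ?].
      by exists q; rewrite lte_fin.
    have /rat_in_itvoo[q] : fine (H x) < fine (H x) + 1 by rewrite ltrDl.
    by rewrite in_itv/= => /andP[? ?] _; exists q; rewrite ?lte_fin ?ltry.
  have [_ /(_ x qg) Bx _] := BP q.
  have := hH q x; rewrite /h (mem_set Bx) leNgt => /negP; apply.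
  by apply: lt_le_trans Hq _; rewrite lee_fin le_max lexx orbT.
exists H; split => //.
have mH : measurable_fun setT H.
  apply: (measurability _ (ErealGenOInfty.measurableE R)) => _ [_ [r ->] <-].
  rewrite setTI (_ : _ @^-1` _ = [set x | (r%:E < H x)%E]); first exact: SM.
  by apply/seteqP; split => x /=; rewrite in_itv /= ?leey ?andbT.
apply: ge0_ae_eq_integral => //.
(* H exceeds g only on the union of the excess sets N q with q > 0. Integrability of g makes B q of
   finite measure, so that equality of measures implies that N q is null. *)
pose N q := B q `\` [set x | ((ratr q : R)%:E < g x)%E].
have NN (q : rat) : 0 < q -> mu.-negligible (N q).
  move=> q0; have q0' : 0 < (ratr q : R) by rewrite ltr0q.
  have [SB gB muB] := BP q.
  have muBoo : (mu (B q) < +oo)%E.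
    rewrite muB; apply: (@le_lt_trans _ _ ((ratr q : R)^-1%:E * \int[mu]_x g x)%E); last first.
      by rewrite lte_mul_pinfty// ?lee_fin ?invr_ge0 ?ltW.
    rewrite lee_pdivlMl//.
    have := le_integral_abse mu measurableT mg q0'.
    rewrite (eq_integral g); last by move=> x _; rewrite gee0_abs.
    apply: le_trans; rewrite lee_pmul2l//; apply: le_measure; rewrite ?inE//.
      rewrite setTI -[X in measurable X]setTI.
      by apply: emeasurable_fun_c_infty => //; exact: measurableT_comp.
    by move=> x /= ?; split => //; rewrite gee0_abs// ltW.
  exists (N q); split => //; first by apply: measurableD => //; exact: SM.
  rewrite measureD//; last exact: SM.
  rewrite (_ : B q `&` _ = [set x | ((ratr q : R)%:E < g x)%E]); last exact/setIidPr.
  by rewrite -[X in (X - _)%E]/(mu (B q)) muB subee// ge0_fin_numE// -muB.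
pose F k := if (unpickle k : option rat) is Some q then (if 0 < q then N q else set0) else set0.
apply: (@negligibleS _ _ _ mu (\bigcup_k F k)).
  move=> x /= /not_implyP[_ HNg]; apply: contrapT => Nx; apply: HNg.
  apply/eqP; rewrite eq_le gH andbT; apply: ge_ereal_sup => _ [q _ <-].
  rewrite /h; case: ifPn => // /set_mem Bx.
  have [q0|q0] := ltP 0 q; last by rewrite max_l// lerq0.
  rewrite max_r ?ler0q ?(ltW q0)//; apply: ltW; apply: contrapT => ngq.
  by apply: Nx; exists (pickle q); [|rewrite /F pickleK q0].
apply: negligible_bigcup => k; rewrite /F.
by case: unpickle => [q|]; [case: ifPn => [/NN //|_]|]; exact: negligible_set0.
Qed.

(** * Borel functions of x - y on the product space *)

Section convolution.
Context {R : realType} {n : nat}.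
Local Notation T := (Rn R n).
Local Notation mu := (@leb R n).
Local Notation boxes := (<<s range (@box R n) >>).
Local Open Scope ereal_scope.
Implicit Types (H g : T -> \bar R).

(** The sets C with measurable preimage form a sigma-algebra, and for a box the preimage is a finite
    intersection of conditions on the coordinates x_i - y_i. *)
Lemma measurable_sub_box (C : set T) : boxes C ->
  measurable [set z : T * T | C (z.1 - z.2)%R].
Proof.
move: C; apply: smallest_sub; last first.
  move=> _ [[[a b]|] _ <-] /=; last first.
    by rewrite (_ : mkset _ = set0) //; apply/seteqP; split.
  rewrite (_ : mkset _ = \bigcap_(i in [set: 'I_n])
     ((fun z : T * T => (z.1 0 i - z.2 0 i)%R) @^-1` [set` `]a 0%R i, b 0%R i]%R])).
    apply: fin_bigcap_measurable => [|i _]; first exact: finite_finset.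
    rewrite -[X in measurable X]setTI.
    have mi := @measurable_coord R n i.
    have m : measurable_fun setT (fun z : T * T => (z.1 0 i - z.2 0 i)%R).
      apply: measurable_funB.
        exact: (measurableT_comp mi measurable_fst).
      exact: (measurableT_comp mi measurable_snd).
    exact: m.
  apply/seteqP; split => z /= h i.
    by have := h i; rewrite !mxE => + _ /=; rewrite in_itv.
  by have := h i Logic.I; rewrite /= in_itv/= !mxE.
split.
- by rewrite (_ : mkset _ = set0) //; apply/seteqP; split.
- move=> A mA; rewrite (_ : mkset _ = ~` [set z : T * T | A (z.1 - z.2)%R]).
    exact: measurableC.
  by apply/seteqP; split => z /=; [case|].
- move=> F mF; rewrite (_ : mkset _ = \bigcup_k [set z : T * T | F k (z.1 - z.2)%R]).
    exact: bigcupT_measurable.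
  by apply/seteqP; split => z.
Qed.

(** Borel measurability in terms of superlevel sets, the form in which [hull_majorant] delivers
    it. *)
Definition box_measurable H := forall r : R, boxes [set x | r%:E < H x].

Lemma box_measurable_fun H : box_measurable H -> measurable_fun setT H.
Proof.
move=> mH; apply: (measurability _ (ErealGenOInfty.measurableE R)) => _ [_ [r ->] <-].
rewrite setTI (_ : _ @^-1` _ = [set x | r%:E < H x]).
  exact: box_hull_measurable.
by apply/seteqP; split => x /=; rewrite in_itv /= ?leey ?andbT.
Qed.

Lemma box_measurable_sub H : box_measurable H ->
  measurable_fun setT (fun z : T * T => H (z.1 - z.2)%R).
Proof.
move=> mH; apply: (measurability _ (ErealGenOInfty.measurableE R)) => _ [_ [r ->] <-].
rewrite setTI (_ : _ @^-1` _ = [set z : T * T | [set x | r%:E < H x] (z.1 - z.2)%R]).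
  exact: measurable_sub_box.
by apply/seteqP; split => x /=; rewrite in_itv /= ?leey ?andbT.
Qed.

(** A translation is a composite of two reflections: x - y = 0 - (y - x). *)
Lemma ge0_integral_translate H (y : T) : measurable_fun setT H ->
  (forall x, 0 <= H x) -> \int[mu]_x H (x - y)%R = \int[mu]_x H x.
Proof.
move=> mH H0.
have mK : measurable_fun setT (fun z : T => H (0 - z)%R).
  exact: (measurableT_comp mH (measurable_reflection (0%R : T))).
rewrite -(ge0_integral_reflection (0%R : T) H mH H0).
rewrite -(ge0_integral_reflection y _ mK) => [|z]; last exact: H0.
by apply: eq_integral => x _; rewrite sub0r opprB.
Qed.

End convolution.

(** * Bessel capacities *)

(** For a > l, write a = l^(1-s) l^(s-1) a and bound l^(s-1) by a^(s-1). The free parameter l trades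
    a small multiple of the measure against a large multiple of the integral of f^s. *)
Lemma le_add_powR (R : realType) (a l s : R) : (0 <= a) -> (0 < l) -> (1 <= s) ->
  (a <= l + l `^ (1 - s) * a `^ s).
Proof.
move=> a0 l0 s1; have [al|la] := leP a l.
  by rewrite ler_wpDr// mulr_ge0 ?powR_ge0.
rewrite ler_wpDl ?(ltW l0)//.
have aa : (a = l `^ (1 - s) * (l `^ (s - 1) * a)).
  rewrite mulrA -powRD; last by rewrite (gt_eqF l0) implybT.
  by rewrite (_ : 1 - s + (s - 1) = 0) ?powRr0 ?mul1r//; ring.
rewrite {1}aa ler_wpM2l ?powR_ge0//.
have -> : (a `^ s = a `^ (s - 1) * a).
  by rewrite -{3}(powRr1 a0) -powRD ?subrK// (gt_eqF (lt_trans l0 la)) implybT.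
by rewrite ler_wpM2r// ge0_ler_powR ?nnegrE ?subr_ge0 ?(ltW l0)// ltW.
Qed.

Section kernel.
Context d (T : measurableType d) (R : realType).
Variable mu : {sigma_finite_measure set T -> \bar R}.
Local Open Scope ereal_scope.

(** Integrating [le_add_powR] against the kernel bounds F f by l c + l^(1-s) F(f^s). Chebyshev's
    inequality at level 1 on Q and Tonelli's theorem finish. The set A is defined by the majorant k,
    because the integral of g x y against f is not known to be measurable in x. *)
Lemma kernel_weak_type (k : T * T -> \bar R) (c : \bar R) (g : T -> T -> R)
    (f : T -> R) (l s : R) (Q : set T) :
  measurable_fun setT k -> (forall z, 0 <= k z) ->
  (forall x, measurable_fun setT (g x)) ->
  (forall x y, `|g x y|%:E <= k (x, y)) ->
  (forall x, \int[mu]_y k (x, y) = c) -> (forall y, \int[mu]_x k (x, y) = c) ->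
  measurable_fun setT f -> (forall x, 0 <= f x)%R -> (0 < l)%R -> (1 <= s)%R ->
  measurable Q -> exists A, [/\ measurable A,
    Q `&` [set x | 1 <= \int[mu]_y (g x y * f y)%:E] `<=` A &
    mu A <= l%:E * c * mu Q +
      (l `^ (1 - s))%:E * (c * \int[mu]_x (f x `^ s)%:E)].
Proof.
move=> mk k0 mg gk kx ky mf f0 l0 s1 mQ.
have mkx x : measurable_fun setT (fun y => k (x, y)) by exact: measurable_fun_pair2.
have mky y : measurable_fun setT (fun x => k (x, y)) by exact: measurable_fun_pair1.
have c0 : 0 <= c by rewrite -(kx point) integral_ge0.
pose fs x := (f x `^ s)%R.
have fs0 x : (0 <= fs x)%R by exact: powR_ge0.
have mfs : measurable_fun setT fs.
  exact: (measurableT_comp (measurable_powR s) mf).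
pose kk (h : T -> R) (z : T * T) := k z * (h z.2)%:E.
have mkk (h : T -> R) : measurable_fun setT h -> measurable_fun setT (kk h).
  move=> mh; apply: emeasurable_funM => //; apply/measurable_EFinP.
  exact: (measurableT_comp mh).
have kk0 (h : T -> R) z : (forall x, 0 <= h x)%R -> 0 <= kk h z.
  by move=> h0; rewrite mule_ge0// lee_fin.
pose F (h : T -> R) x := \int[mu]_y kk h (x, y).
have mF (h : T -> R) : measurable_fun setT h -> (forall x, 0 <= h x)%R ->
    measurable_fun setT (F h).
  move=> mh h0; apply: (@measurable_fun_fubini_tonelli_F _ _ T T R mu) => //.
    exact: mkk.
  by move=> z; exact: kk0.
have F0 (h : T -> R) x : (forall x, 0 <= h x)%R -> 0 <= F h x.
  by move=> h0; apply: integral_ge0 => y _; exact: kk0.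
have mkkx (h : T -> R) x : measurable_fun setT h -> measurable_fun setT (fun y => kk h (x, y)).
  by move=> mh; exact: (measurable_fun_pair2 x (mkk _ mh)).
have gF x : \int[mu]_y (g x y * f y)%:E <= F f x.
  have mgf : measurable_fun setT (fun y => (g x y * f y)%:E).
    by apply/measurable_EFinP; exact: measurable_funM.
  apply: le_trans (lee_abs _) _; apply: le_trans (le_abse_integral mu measurableT mgf) _.
  apply: ge0_le_integral => //; [exact: measurableT_comp|exact: mkkx|].
  move=> y _; rewrite /kk /= normrM EFinM (ger0_norm (f0 y)).
  by rewrite lee_wpmul2r ?lee_fin.
have FF x : F f x <= l%:E * c + (l `^ (1 - s))%:E * F fs x.
  rewrite -[X in l%:E * X](kx x) -!ge0_integralZl ?lee_fin ?powR_ge0 ?(ltW l0)//; last 2 first.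
  - exact: mkkx.
  - by move=> y _; exact: kk0.
  have mkkfs := mkkx _ x mfs.
  rewrite -ge0_integralD//; last 4 first.
  - by move=> y _; rewrite mule_ge0// lee_fin ltW.
  - by apply: emeasurable_funM.
  - by move=> y _; rewrite mule_ge0 ?kk0// lee_fin powR_ge0.
  - by apply: emeasurable_funM.
  apply: ge0_le_integral => //.
  - by move=> y _; exact: kk0.
  - exact: mkkx.
  - by apply: emeasurable_funD; exact: emeasurable_funM.
  move=> y _; rewrite /kk /= muleCA (muleC l%:E) -ge0_muleDr ?lee_fin ?mulr_ge0 ?powR_ge0
    ?(ltW l0)//.
  by rewrite lee_wpmul2l// lee_fin le_add_powR.
have mFQ := measurable_funS measurableT (@subsetT _ Q) (mF f mf f0).
have mFsQ := measurable_funS measurableT (@subsetT _ Q) (mF fs mfs fs0).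
exists (Q `&` [set x | 1%R%:E <= `|F f x|]); split.
- by apply: emeasurable_fun_c_infty => //; exact: measurableT_comp.
- move=> x [Qx cx]; split => //=.
  by rewrite gee0_abs ?F0//; exact: le_trans (gF x).
rewrite -[leLHS]mul1e; apply: le_trans (le_integral_abse mu mQ mFQ ltr01) _.
apply: (@le_trans _ _ (\int[mu]_(x in Q) (l%:E * c + (l `^ (1 - s))%:E * F fs x))).
  apply: ge0_le_integral => //.
  - exact: (measurableT_comp _ mFQ).
  - by apply: emeasurable_funD => //; exact: emeasurable_funM.
  by move=> x _; rewrite gee0_abs ?F0.
rewrite ge0_integralD//; last 3 first.
- by move=> x _; rewrite mule_ge0 ?lee_fin ?(ltW l0).
- by move=> x _; rewrite mule_ge0 ?lee_fin ?powR_ge0 ?F0.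
- exact: emeasurable_funM.
rewrite integral_cst//= leeD2l// ge0_integralZl ?lee_fin ?powR_ge0//; last first.
  by move=> x _; exact: F0.
rewrite lee_wpmul2l ?lee_fin ?powR_ge0//.
apply: le_trans (_ : _ <= \int[mu]_x F fs x) _.
  by apply: ge0_subset_integral => //; [exact: mF|move=> x _; exact: F0].
rewrite /F (@fubini_tonelli _ _ T T R mu mu (kk fs))//; last 2 first.
- exact: mkk.
- by move=> z; exact: kk0.
rewrite -ge0_integralZl//; last 2 first.
- exact/measurable_EFinP.
- by move=> y _; rewrite lee_fin powR_ge0.
rewrite le_eqVlt; apply/orP; left; apply/eqP; apply: eq_integral => y _.
by rewrite /kk /= ge0_integralZr ?ky// lee_fin.
Qed.

End kernel.

Section capacity_basics.
Context {R : realType} {n : nat}.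
Local Notation T := (Rn R n).
Local Notation mu := (@leb R n).
Local Open Scope ereal_scope.
Implicit Types (G f : T -> R) (s : R) (E A B : set T).

Lemma Lnorm_poweR s f : (0 < s)%R ->
  'N[mu]_(s%:E)[EFin \o f] `^ s = \int[mu]_x (`|f x|%R `^ s)%:E.
Proof.
move=> s0; rewrite unlock /= -poweRrM mulVf ?gt_eqF//.
rewrite poweRe1; last by apply: integral_ge0 => x _; rewrite lee_fin powR_ge0.
by apply: eq_integral.
Qed.

Lemma capacity_ge0 G s E : 0 <= capacity G s E.
Proof. by apply: le_ereal_inf_tmp => _ [f _ <-]; exact: poweR_ge0. Qed.

Lemma le_capacity G s A B : A `<=` B -> capacity G s A <= capacity G s B.
Proof.
move=> AB; apply/ereal_inf_le_tmp => _ [f [mf f0 Bf] <-].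
by exists f => //; split => // x /AB; exact: Bf.
Qed.

Lemma capacity_le G s E f : (0 < s)%R -> measurable_fun setT f ->
  (forall x, 0 <= f x)%R -> (forall x, E x -> 1 <= convolution G f x) ->
  capacity G s E <= \int[mu]_x (f x `^ s)%:E.
Proof.
move=> s0 mf f0 Ef; apply: ereal_inf_lbound; exists f => //.
by rewrite (Lnorm_poweR _ f s0); apply: eq_integral => x _; rewrite ger0_norm.
Qed.

Lemma capacity_lt G s E (e : R) : (0 < s)%R -> capacity G s E < e%:E ->
  exists f, [/\ measurable_fun setT f, forall x, (0 <= f x)%R,
    forall x, E x -> 1 <= convolution G f x & \int[mu]_x (f x `^ s)%:E < e%:E].
Proof.
move=> s0 /ereal_inf_lt[_ [f [mf f0 Ef] <-] fe].
exists f; split => //; move: fe; rewrite (Lnorm_poweR _ f s0); apply: le_lt_trans.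
by under eq_integral do rewrite -{1}(ger0_norm (f0 _)).
Qed.

Lemma capacity_set0 G s : (0 < s)%R -> capacity G s set0 = 0.
Proof.
move=> s0; apply/eqP; rewrite eq_le capacity_ge0 andbT.
apply: le_trans (@capacity_le G s set0 (cst 0%R) s0 _ _ _) _ => //=.
by under eq_integral do rewrite powR0 ?gt_eqF//; rewrite integral0.
Qed.

End capacity_basics.

Lemma measurable_EFinM d (T : measurableType d) (R : realType) (D : set T) (f g : T -> R) :
  measurable_fun D f -> measurable_fun D g ->
  measurable_fun D (fun x => (f x * g x)%:E).
Proof. by move=> mf mg; apply/measurable_EFinP; exact: measurable_funM. Qed.

(** A representative of the kernel may take negative values, so the substitution y -> x - y is
    needed for signed functions too. *)
Lemma integral_measure_preserving d (T : measurableType d) (R : realType)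
    (mu : {measure set T -> \bar R}) (phi : T -> T) (f : T -> \bar R) :
  measurable_fun setT phi -> (forall A, measurable A -> mu (phi @^-1` A) = mu A) ->
  measurable_fun setT f ->
  (\int[mu]_x f (phi x) = \int[mu]_x f x)%E.
Proof.
move=> mphi muphi mf; rewrite [LHS]integralE [RHS]integralE.
rewrite -(ge0_integral_measure_preserving _ _ _ _ _ _ mphi muphi (measurable_funepos mf)
  (funepos_ge0 f)).
rewrite -(ge0_integral_measure_preserving _ _ _ _ _ _ mphi muphi (measurable_funeneg mf)
  (funeneg_ge0 f)).
by congr (_ - _)%E; apply: eq_integral => x _; rewrite ?funeposE ?funenegE.
Qed.

Lemma integral_tail d (T : measurableType d) (R : realType)
    (mu : {measure set T -> \bar R}) (g : T -> \bar R) (F : nat -> set T) (e : R) :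
  measurable_fun setT g -> (forall x, 0 <= g x)%E -> (\int[mu]_x g x < +oo)%E ->
  nondecreasing_seq F -> (forall k, measurable (F k)) -> \bigcup_k F k = setT ->
  0 < e -> exists k, (\int[mu]_(x in ~` F k) g x <= e%:E)%E.
Proof.
move=> mg g0 goo ndF mF FT e0.
have mgD D : measurable_fun D g by exact: measurable_funS (@subsetT _ _) mg.
have gfin : (\int[mu]_x g x)%E \is a fin_num by rewrite ge0_fin_numE// integral_ge0.
pose u k := (\int[mu]_(x in F k) g x)%E.
have ndu : nondecreasing_seq u.
  by apply: ge0_nondecreasing_set_nondecreasing_integral => // i; exact: mgD.
have cu : u @ \oo --> (\int[mu]_x g x)%E.
  rewrite -FT; apply: ge0_nondecreasing_set_cvg_integral => // i; exact: mgD.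
have supu : ereal_sup (range u) = (\int[mu]_x g x)%E.
  have := ereal_nondecreasing_cvgn ndu.
  by move=> /(cvg_lim (@ereal_hausdorff _)) <-; exact/cvg_lim.
have : (\int[mu]_x g x - e%:E < ereal_sup (range u))%E.
  by rewrite supu lteBlDr// lteDl ?lte_fin.
move=> /ereal_sup_gt[_ [k _ <-] uk]; exists k.
have : (\int[mu]_x g x = u k + \int[mu]_(x in ~` F k) g x)%E.
  rewrite -ge0_integral_setU ?setUv//; first exact: measurableC.
  exact/disj_setPCl.
move=> ge; have uk0 : u k \is a fin_num.
  rewrite ge0_fin_numE; last exact: integral_ge0.
  by apply: le_lt_trans goo; rewrite ge leeDl// integral_ge0.
move: uk; rewrite lteBlDr// ge.
by rewrite lteD2lE// => /ltW.
Qed.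

(** The integrand is at least 2 G - 2 |G| 1_(~A), whose integral is at least 2 - 2 (1/2) = 1. This
    is where the constants 2 and 1/2 come from. *)
Lemma ge1_integral_indic d (T : measurableType d) (R : realType)
    (mu : {measure set T -> \bar R}) (G : T -> R) (A : set T) :
  mu.-integrable setT (EFin \o G) -> (\int[mu]_x (G x)%:E = 1)%E ->
  measurable A -> (\int[mu]_(x in ~` A) `|G x|%:E <= 2^-1%:E)%E ->
  (1 <= \int[mu]_x (G x * (2 * \1_A x))%:E)%E.
Proof.
move=> iG G1 mA GA.
have iGA : mu.-integrable setT (fun x => (2 * `|G x| * \1_(~` A) x)%:E).
  apply: (@le_integrable _ _ _ mu setT measurableT _ (fun x => 2%:E * (EFin \o G) x)%E).
  - apply/measurable_EFinP; apply: measurable_funM.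
      apply: measurable_funM => //; apply: measurableT_comp => //.
      by have /integrableP[/measurable_EFinP] := iG.
    exact/measurable_indic/measurableC.
  - move=> x _; rewrite /= lee_fin !normrM normr_id indicE.
    by rewrite ler_piMr// ?mulr_ge0//; case: (_ \in _); rewrite ?normr1 ?normr0.
  - exact: integrableZl.
have i2G : mu.-integrable setT (fun x => (2%:E * (EFin \o G) x)%E) by exact: integrableZl.
apply: (@le_trans _ _ (\int[mu]_x (2%:E * (G x)%:E - (2 * `|G x| * \1_(~` A) x)%:E))%E).
  rewrite integralB// integralZl// G1 mule1.
  rewrite (_ : (\int[mu]_x (2 * `|G x| * \1_(~` A) x)%:E =
    2%:E * \int[mu]_(x in ~` A) `|G x|%:E)%E); last first.
    rewrite [in RHS]integral_mkcond -ge0_integralZl//; last 2 first.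
    - apply/(measurable_restrictT _ (measurableC mA)).
      apply: measurable_funTS; apply/measurable_EFinP; apply: measurableT_comp => //.
      by have /integrableP[/measurable_EFinP] := iG.
    - by move=> x _; apply: erestrict_ge0 => y _; rewrite lee_fin.
    apply: eq_integral => x _; rewrite patchE indicE.
    by case: ifP => _; rewrite ?mulr1 ?mulr0 ?mule0.
  have : (2%:E * \int[mu]_(x in ~` A) `|G x|%:E <= 1)%E.
    apply: (@le_trans _ _ (2%:E * 2^-1%:E)%E); first by rewrite lee_wpmul2l.
    by rewrite -EFinM divff.
  case: (2%:E * _)%E => [r| |]; [|by rewrite leye_eq|by move=> _ /=; rewrite leey].
  by rewrite -EFinB !lee_fin => ?; lra.
apply: le_integral => //.
- exact: integrableB.
- apply: (@le_integrable _ _ _ mu setT measurableT _ (fun x => 2%:E * (EFin \o G) x)%E) => //.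
    apply/measurable_EFinP; apply: measurable_funM.
      by have /integrableP[/measurable_EFinP] := iG.
    by apply: measurable_funM => //; exact: measurable_indic.
  move=> x _; rewrite /= lee_fin mulrCA normrM [leRHS]normrM ler_wpM2l// normrM.
  by rewrite ler_piMr// indicE; case: (_ \in _); rewrite ?normr1 ?normr0.
move=> x _; rewrite lee_fin !indicE in_setC.
case: (_ \in A) => /=; rewrite ?mulr1 ?mulr0; first by lra.
by have := ler_norm (G x); lra.
Qed.

Section capacity_bessel.
Context {R : realType} {n : nat}.
Local Notation T := (Rn R n).
Local Notation mu := (@leb R n).
Implicit Types (G f : T -> R) (s : R) (E A B K : set T).

Lemma bessel_kernel_integral alpha G : bessel_kernel alpha G ->
  mu.-integrable setT (EFin \o G) /\ (\int[mu]_x (G x)%:E = 1)%E.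
Proof.
move=> [iG /(_ 0)]; rewrite /fourier => -[G1 _]; split => //.
move: G1.
rewrite (_ : dot 0 0 = 0); last first.
  by rewrite /dot big1// => i _; rewrite !mxE mul0r.
rewrite addr0 powR1 /Rintegral => G1.
rewrite -[RHS]/(1%:E) -G1 fineK.
  apply: eq_integral => x _; rewrite (_ : dot x 0 = 0) ?cos0 ?mulr1//.
  by rewrite /dot big1// => i _; rewrite !mxE mulr0.
under eq_integral => x _.
  rewrite (_ : dot x 0 = 0) ?cos0 ?mulr1; last first.
    by rewrite /dot big1// => i _; rewrite !mxE mulr0.
  over.
exact: integrable_fin_num.
Qed.

Lemma capacity_compact_lty G s K :
  mu.-integrable setT (EFin \o G) -> (\int[mu]_x (G x)%:E = 1)%E -> 0 < s ->
  compact K -> (capacity G s K < +oo)%E.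
Proof.
move=> iG G1 s0 /compact_sub_cube[r [r0 Kr]].
have /integrableP[/measurable_EFinP mG Goo] := iG.
have mG' : measurable_fun setT (fun x => `|G x|%:E).
  by apply/measurable_EFinP; exact: measurableT_comp.
have [||||k kG] := @integral_tail _ T R mu (fun x => `|G x|%:E) (fun k => cube k%:R) 2^-1
  mG' (fun x => normr_ge0 _) Goo.
- by move=> i j ij; rewrite subsetEset; apply: subset_cube; rewrite ler_nat.
- by move=> i; exact: measurable_cube.
- exact: cube_exhaust.
- by rewrite invr_gt0.
(* For x in K and z in the cube of radius k, x - z lies in Q. Hence Q seen from any x in K captures
   all of |G| except a mass of at most 1/2. *)
pose Q : set T := cube (r + k%:R).
have mQ : measurable Q by exact: measurable_cube.
have mf : measurable_fun setT (fun x : T => 2 * \1_Q x : R).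
  by apply: measurable_funM => //; exact: measurable_indic.
have f0 x : 0 <= 2 * \1_Q x :> R by rewrite mulr_ge0.
apply: le_lt_trans (@capacity_le _ _ G s K _ s0 mf f0 _) _.
  move=> x Kx.
  pose A : set T := (fun z => x - z) @^-1` Q.
  have mA : measurable A.
    by rewrite /A -[X in measurable X]setTI; exact: measurable_reflection.
  have AG : (\int[mu]_(x in ~` A) `|G x|%:E <= 2^-1%:E)%E.
    apply: le_trans kG; apply: (ge0_subset_integral mu (measurableC mA)
      (measurableC (measurable_cube _)) (measurable_funTS mG') (fun x _ => normr_ge0 _)).
    apply: subsetC => z zk i; rewrite !mxE; apply: le_trans (ler_normB _ _) _.
    by apply: lerD; [exact: Kr|exact: zk].
  apply: le_trans (ge1_integral_indic _ _ _ mu G A iG G1 mA AG) _.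
  pose h (z : T) := (G z * (2 * \1_Q (x - z)))%:E.
  have mh : measurable_fun setT h.
    exact: (measurable_EFinM _ _ _ _ _ _ mG (measurableT_comp mf (measurable_reflection x))).
  have := integral_measure_preserving _ _ _ mu _ h (measurable_reflection x) (fun A _ =>
    leb_reflection x A) mh.
  rewrite /h => <-; rewrite /convolution le_eqVlt; apply/orP; left; apply/eqP.
  by apply: eq_integral => y _; rewrite subKr.
rewrite (eq_integral (fun x => (2 `^ s)%:E * (\1_Q x)%:E)%E); last first.
  move=> x _; rewrite indicE -EFinM; case: (_ \in _); first by rewrite !mulr1.
  by rewrite !mulr0 powR0// gt_eqF.
have m1Q : measurable_fun setT (fun x : T => (\1_Q x : R)%:E).
  exact/measurable_EFinP/measurable_indic.
rewrite (ge0_integralZl_EFin mu measurableT (fun x _ => _ : (0 <= (\1_Q x : R)%:E)%E) m1Q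
  (powR_ge0 _ _)); last first.
  by move=> x _; rewrite lee_fin.
by rewrite integral_indic// setIT lte_mul_pinfty ?lee_fin ?powR_ge0// leb_cube_lty.
Qed.

(** E lies in {G * f >= 1} with the integral of f^s as small as desired, so the weak-type bound
    applies. It is used on one cube at a time because it contains the measure of the cube. *)
Lemma capacity0_null G s E : mu.-integrable setT (EFin \o G) -> 1 <= s ->
  capacity G s E = 0%E -> mu E = 0%E.
Proof.
move=> /integrableP[/measurable_EFinP mG Goo] s1 E0.
have s0 : 0 < s by exact: lt_le_trans s1.
have mG' : measurable_fun setT (fun x => `|G x|%:E).
  by apply/measurable_EFinP; exact: measurableT_comp.
have [|H [GH bH HE]] := hull_majorant _ T R mu (<<s range (@box R n) >>) _
  (smallest_sigma_algebra _ _) box_hull_measurable _ mG' (fun x => normr_ge0 (G x)) Goo.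
  by move=> A _; exact: box_hull.
have H0 x : (0 <= H x)%E by apply: le_trans (GH x); rewrite lee_fin.
have mH := box_measurable_fun H bH.
have Hoo : (\int[mu]_x H x < +oo)%E by rewrite HE.
pose h := fine (\int[mu]_x H x)%E.
have hE : (\int[mu]_x H x)%E = h%:E.
  by rewrite fineK// ge0_fin_numE// integral_ge0.
have h0 : 0 <= h by rewrite -lee_fin -hE integral_ge0.
have aux (a b : R) : 0 < a -> 0 <= b -> a / (b + 1) * b <= a.
  move=> a0 b0; rewrite mulrAC ler_pdivrMr ?ltr_wpDl// ler_wpM2l ?ltW//.
  by rewrite ltrDl.
have EQ k : mu (cube k%:R `&` E) = 0%E.
  apply/eqP; rewrite eq_le outer_measure_ge0 andbT; apply/lee_addgt0Pr => e e0.
  rewrite add0e.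
  pose q := fine (mu (cube k%:R)).
  have qE : mu (cube k%:R) = q%:E by rewrite fineK// ge0_fin_numE// leb_cube_lty.
  have q0 : 0 <= q by rewrite -lee_fin -qE.
  (* The order of choices matters: l makes the first term at most e/2; then l^(1-s) h is a fixed
     constant c, and f is taken with integral of f^s below e/2/(c+1). Adding 1 avoids zero
     denominators. *)
  pose l := e / 2 / (h * q + 1).
  have hq : 0 < h * q + 1 by rewrite ltr_wpDl// mulr_ge0.
  have l0 : 0 < l by rewrite !divr_gt0.
  pose c := l `^ (1 - s) * h.
  have c0 : 0 <= c by rewrite mulr_ge0// powR_ge0.
  have c1 : 0 < c + 1 by rewrite ltr_wpDl.
  have [f [mf f0 Ef fe]] : exists f, [/\ measurable_fun setT f, forall x, (0 <= f x)%R,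
      forall x, E x -> (1 <= convolution G f x)%E &
      (\int[mu]_x (f x `^ s)%:E < (e / 2 / (c + 1))%:E)%E].
    by apply: capacity_lt => //; rewrite E0 lte_fin !divr_gt0.
  have mk := box_measurable_sub H bH.
  have kx x : (\int[mu]_y H (x - y)%R = h%:E)%E.
    by rewrite -hE; exact: (ge0_integral_reflection x H mH H0).
  have ky y : (\int[mu]_x H (x - y)%R = h%:E)%E.
    by rewrite -hE; exact: (ge0_integral_translate H y mH H0).
  have [A [mA EA muA]] := kernel_weak_type _ T R mu (fun z : T * T => H (z.1 - z.2)) h%:E
    (fun x y => G (x - y)) f l s (cube k%:R) mk (fun z => H0 _)
    (fun x => measurableT_comp mG (measurable_reflection x)) (fun x y => GH (x - y)) kx ky
    mf f0 l0 s1 (measurable_cube _).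
  apply: le_trans (le_outer_measure _ _ _ (_ : _ `<=` A)) _.
    by move=> x [Qx Ex]; apply: EA; split => //; exact: Ef.
  have {}muA : (mu A <= l%:E * h%:E * q%:E +
      (l `^ (1 - s))%:E * (h%:E * \int[mu]_x (f x `^ s)%:E))%E by rewrite -qE.
  apply: le_trans muA _.
  have fsE : (\int[mu]_x (f x `^ s)%:E)%E \is a fin_num.
    rewrite ge0_fin_numE; first by rewrite (lt_trans fe) ?ltry.
    by apply: integral_ge0 => x _; rewrite lee_fin powR_ge0.
  move: fe; rewrite -(fineK fsE) lte_fin => fe.
  rewrite -!EFinM -EFinD lee_fin [leRHS]splitr.
  have e20 : 0 < e / 2 by rewrite divr_gt0.
  apply: lerD.
    by rewrite -mulrA; apply: aux => //; exact: mulr_ge0.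
  rewrite mulrA -/c; apply: le_trans (_ : _ <= c * (e / 2 / (c + 1))) _.
    by rewrite ler_wpM2l// ltW.
  by rewrite mulrC; exact: (aux _ _ e20 c0).
apply/eqP; rewrite eq_le outer_measure_ge0 andbT.
rewrite -(setIT E) -cube_exhaust setI_bigcupr.
apply: le_trans (outer_measure_sigma_subadditive _ _) _.
by rewrite eseries0// => k _ _; rewrite setIC; exact: EQ.
Qed.

End capacity_bessel.

(** * Measurability of level sets and the layer-cake formula *)

Lemma measurable_fun_inve d (T : measurableType d) (R : realType) (D : set T)
    (v : T -> \bar R) : measurable_fun D v -> (forall x, D x -> (0 <= v x)%E) ->
  measurable_fun D (fun x => (v x)^-1)%E.
Proof.
move=> mv v0 mD; apply: (measurability _ (ErealGenOInfty.measurableE R)) => //.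
move=> _ [_ [r ->] <-]; have [r0|r0] := ltP r 0.
  rewrite (_ : _ `&` _ = D)//; apply/setIidPl => x Dx /=.
  by rewrite in_itv/= andbT (lt_le_trans (_ : (r%:E < 0)%E))// inve_ge0 v0.
rewrite (_ : _ `&` _ = D `&` [set x | (v x < r%:E^-1)%E]).
  exact: emeasurable_fun_infty_o.
apply/seteqP; split => x [Dx] /=; rewrite in_itv/= andbT => xr; split => //=.
  by rewrite -inve_pgt// ?inE/= ?v0 ?lee_fin.
by rewrite inve_pgt// ?inE/= ?v0 ?lee_fin.
Qed.

(** Superlevel sets of a monotone function are intervals. This makes t -> cap {w > t} measurable
    from monotonicity of the capacity alone. *)
Lemma nonincreasing_measurable (R : realType) (u : R -> \bar R) :
  (forall a b, a <= b -> (u b <= u a)%E) -> measurable_fun setT u.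
Proof.
move=> ndu; apply: (measurability _ (ErealGenOInfty.measurableE R)) => //.
move=> _ [_ [r ->] <-]; rewrite setTI; apply: is_interval_measurable => a b /=.
rewrite !in_itv/= !andbT => ra rb c /andP[ac cb].
by rewrite in_itv/= andbT; exact: lt_le_trans (ndu _ _ cb).
Qed.

(** The region t < w(x) is the union over rational q of the rectangles {q < w} x {t < q}. *)
Lemma measurable_gt_snd d (T : measurableType d) (R : realType) (w : T -> \bar R) :
  measurable_fun setT w ->
  measurable [set z : T * measurableTypeR R | (z.2%:E < w z.1)%E].
Proof.
move=> mw.
rewrite (_ : [set _ | _] = \bigcup_(q in [set: rat])
   (fst @^-1` [set x | ((ratr q : R)%:E < w x)%E] `&` snd @^-1` `]-oo, ratr q[%classic)).
  apply: bigcupT_measurable_rat => q; apply: measurableI.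
    rewrite -[X in measurable X]setTI; apply: measurable_fst => //.
    by rewrite -[X in measurable X]setTI; exact: emeasurable_fun_o_infty.
  by rewrite -[X in measurable X]setTI; apply: measurable_snd.
apply/seteqP; split => [[x t]/=|[x t] [q _ /=] [qx]]; last first.
  by rewrite in_itv/= => tq; apply: lt_trans qx; rewrite lte_fin.
move=> tw; suff [q tq qw] : exists2 q : rat, t < ratr q & ((ratr q : R)%:E < w x)%E.
  by exists q => //=; split => //; rewrite in_itv.
case: (w x) tw => [r||] //.
  rewrite lte_fin => /rat_in_itvoo[q]; rewrite in_itv/= => /andP[? ?].
  by exists q; rewrite ?lte_fin.
have /rat_in_itvoo[q] : t < t + 1 by rewrite ltrDl.
by rewrite in_itv/= => /andP[? ?] _; exists q; rewrite ?ltry.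
Qed.

Section layer_cake.
Context d (T : measurableType d) (R : realType).
Variable mu : {sigma_finite_measure set T -> \bar R}.
Local Open Scope ereal_scope.

Lemma lebesgue_itv0_ereal (w : \bar R) : 0 <= w ->
  lebesgue_measure [set t : R | (0 < t)%R /\ t%:E < w] = w.
Proof.
case: w => [r r0|_|//].
  rewrite (_ : [set _ | _] = `]0%R, r[%classic).
    by rewrite lebesgue_measure_itv/= lte_fin; move: r0;
      rewrite lee_fin le_eqVlt => /predU1P[<-|->]; rewrite ?ltxx// oppr0 adde0.
  by apply/seteqP; split => t /=; rewrite in_itv/= lte_fin => /andP.
rewrite (_ : [set _ | _] = `]0%R, +oo[%classic); first by rewrite lebesgue_measure_itv/= ltry.
by apply/seteqP; split => t /=; rewrite in_itv/= andbT ltry; [case|].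
Qed.

(** Tonelli's theorem for F(x) on the region 0 < t < w(x), whose section at x has length w(x).
    Measurability in t is part of the conclusion so that the inner integrals can later be compared
    under the integral sign. *)
Lemma layer_cake (D : set T) (F w : T -> \bar R) :
  measurable D -> measurable_fun setT F -> (forall x, 0 <= F x) ->
  measurable_fun D w -> (forall x, D x -> 0 <= w x) ->
  measurable_fun (`]0%R, +oo[%classic : set R) (fun t : R => \int[mu]_(x in [set x | D x
    /\ t%:E < w x]) F x) /\
  \int[mu]_(x in D) (F x * w x) =
  \int[lebesgue_measure]_(t in `]0%R, +oo[) \int[mu]_(x in [set x | D x /\ t%:E < w x]) F x.
Proof.
move=> mD mF F0 mw w0.
pose w' := w \_ D.
have mw' : measurable_fun setT w' by apply/(measurable_restrictT _ mD).
have w'0 x : 0 <= w' x by apply: erestrict_ge0.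
pose A := [set z : T * measurableTypeR R | z.2%:E < w' z.1] `&` snd @^-1` `]0%R, +oo[%classic.
have mA : measurable A.
  apply: measurableI; first exact: measurable_gt_snd.
  by rewrite -[X in measurable X]setTI; apply: measurable_snd.
pose k (z : T * measurableTypeR R) := F z.1 * (\1_A z)%:E.
have mk : measurable_fun setT k.
  apply: emeasurable_funM; first exact: (measurableT_comp mF measurable_fst).
  exact/measurable_EFinP/measurable_indic.
have k0 z : 0 <= k z by rewrite mule_ge0// lee_fin.
have SE (t : R) : (0 < t)%R -> [set x | D x /\ t%:E < w x] = [set x | t%:E < w' x].
  move=> t0; apply/seteqP; split => x /=; rewrite /w' patchE.
    by case=> Dx; rewrite mem_set.
  by case: ifPn => [/set_mem Dx //|_]; rewrite lte_fin ltNge (ltW t0).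
have kt (t : R) : (0 < t)%R -> \int[mu]_x k (x, t) = \int[mu]_(x in [set x | D x /\ t%:E
  < w x]) F x.
  move=> t0; rewrite SE// [RHS]integral_mkcond; apply: eq_integral => x _.
  rewrite /k /= patchE indicE; case: ifPn => [/set_mem tw|].
    by rewrite mem_set ?mule1//; split => //=; rewrite in_itv/= andbT.
  by rewrite notin_setE => tw; rewrite memNset ?mule0// => -[].
have kt0 (t : R) : (t <= 0)%R -> \int[mu]_x k (x, t) = 0.
  move=> t0; rewrite integral0_eq// => x _; rewrite /k /= indicE memNset ?mule0//.
  by rewrite /A /= => -[_]; rewrite /= in_itv/= andbT ltNge t0.
have kx x : \int[lebesgue_measure]_t k (x, t) = F x * w' x.
  pose At : set (measurableTypeR R) := [set t | A (x, t)].
  have mAt : measurable At.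
    rewrite (_ : At = xsection A x); first exact: measurable_xsection.
    by apply/seteqP; split => t; rewrite /xsection /= inE.
  have m1 : measurable_fun setT (fun t => (\1_At t : R)%:E).
    exact/measurable_EFinP/measurable_indic.
  rewrite (eq_integral (fun t => F x * (\1_At t)%:E))// ge0_integralZl//.
  rewrite integral_indic// setIT -[in RHS](lebesgue_itv0_ereal (w' x))//;
    congr (_ * lebesgue_measure _).
  by apply/seteqP; split => t; rewrite /At /A /= in_itv/= andbT; case.
have mI : measurable_fun setT (fun t : measurableTypeR R => \int[mu]_x k (x, t)).
  exact: (@measurable_fun_fubini_tonelli_G _ _ T (measurableTypeR R) R mu _ mk k0).
split.
  apply: (@eq_measurable_fun _ _ _ _ _ (fun t : measurableTypeR R => \int[mu]_x k (x, t))).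
    by move=> t; rewrite inE/= in_itv/= andbT => /kt.
  exact: measurable_funS (@subsetT _ _) mI.
transitivity (\int[mu]_x \int[lebesgue_measure]_t k (x, t)).
  rewrite integral_mkcond; apply: eq_integral => x _; rewrite kx /w' !patchE.
  by case: ifP; rewrite ?mule0.
rewrite (@fubini_tonelli _ _ T (measurableTypeR R) R mu lebesgue_measure k mk k0).
rewrite [RHS]integral_mkcond; apply: eq_integral => t _; rewrite patchE.
case: ifPn => [|]; first by rewrite inE/= in_itv/= andbT => /kt.
by rewrite notin_setE/= in_itv/= andbT => /negP; rewrite -leNgt => /kt0.
Qed.

End layer_cake.

(** * Densities of set functions and uniqueness of bounded functionals *)

Lemma set_function_density d (T : measurableType d) (R : realType)
    (mu : {sigma_finite_measure set T -> \bar R}) (B : set T) (nu : set T -> R) (c r : R) :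
  measurable B -> (mu B < +oo)%E -> 0 < r ->
  (forall A A', measurable A -> measurable A' -> A `&` A' = set0 ->
    nu (A `|` A') = nu A + nu A') ->
  (forall A, measurable A -> `|nu A| <= c * (fine (mu (A `&` B))) `^ r) ->
  exists h : T -> R, mu.-integrable setT (EFin \o h) /\
    forall A, measurable A -> (nu A)%:E = (\int[mu]_(x in A) (h x)%:E)%E.
Proof.
move=> mB muB r0 nuD nu_le.
have nu_null A : measurable A -> mu (A `&` B) = 0%E -> nu A = 0.
  move=> mA A0; apply/eqP; rewrite -normr_le0; apply: le_trans (nu_le A mA) _.
  by rewrite A0 /= powR0 ?mulr0// gt_eqF.
have nu0 : nu set0 = 0 by apply: nu_null => //; rewrite set0I measure0.
have nu_big (F : (set T)^nat) k : (forall i, measurable (F i)) -> trivIset setT F ->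
    nu (\big[setU/set0]_(i < k) F i) = \sum_(i < k) nu (F i).
  move=> mF tF; elim: k => [|k IH]; first by rewrite !big_ord0.
  rewrite !big_ord_recr/= nuD// ?IH//; first exact: bigsetU_measurable.
  rewrite big_distrl/= big1// => i _.
  by move/trivIsetP : tF => /(_ i k Logic.I Logic.I); apply; rewrite neq_ltn ltn_ord.
(* Finite additivity becomes countable: the remainders of the union, cut to B, decrease to the empty
   set inside a set of finite measure, and nu is bounded by a power of their measure. *)
have nuS : semi_sigma_additive (fun A => (nu A)%:E).
  move=> F mF tF mUF.
  pose S k := \big[setU/set0]_(i < k) F i.
  have mS k : measurable (S k) by exact: bigsetU_measurable.
  have SU k : S k `<=` \bigcup_k F k
    by move=> x; rewrite /S -bigcup_mkord => -[i _ Fx]; exists i.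
  pose D k := (\bigcup_k F k `\` S k) `&` B.
  have mD k : measurable (D k) by apply: measurableI => //; exact: measurableD.
  have D0 : mu (D k) @[k --> \oo] --> 0%E.
    rewrite -(measure0 mu) (_ : set0 = \bigcap_k D k); last first.
      apply/seteqP; split => // x Dx; have [[[i _ Fx] _] _] := Dx 0%N Logic.I.
      have [[_ +] _] := Dx i.+1 Logic.I; apply; rewrite /S -bigcup_mkord.
      by exists i => /=.
    apply: nonincreasing_cvg_mu => //.
    - by apply: le_lt_trans muB; rewrite le_measure ?inE//; exact: subIsetr.
    - exact: bigcapT_measurable.
    - move=> i k ik; rewrite subsetEset /D; apply: setSI; apply: setDS.
      by rewrite /S; apply: subset_bigsetU.
  have DF k : (fine (mu (D k)))%:E = mu (D k).
    rewrite fineK// ge0_fin_numE//; apply: le_lt_trans muB.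
    by rewrite le_measure ?inE//; exact: subIsetr.
  have nuU k : nu (\bigcup_k F k) = nu (S k) + nu (\bigcup_k F k `\` S k).
    by rewrite -nuD ?setDUK ?setDIK//; exact: measurableD.
  apply: (@cvg_trans _ ((fun k => (nu (S k))%:E) @ \oo)); last first.
    apply: cvg_EFin; first by near=> k.
    apply/cvgrPdist_le => e e0.
    pose c' := `|c| + 1.
    have c'0 : 0 < c' by rewrite ltr_wpDl.
    (* With this threshold delta, c' delta^r = e. *)
    have del0 : 0 < (e / c') `^ r^-1 by rewrite powR_gt0// divr_gt0.
    have /fine_cvgP[_ /cvgrPdist_le /(_ _ del0)] := D0.
    apply: filterS => k /=; rewrite sub0r normrN ger0_norm ?fine_ge0// => Dk.
    rewrite (nuU k) addrC addKr; apply: le_trans (nu_le _ _) _; first exact: measurableD.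
    apply: le_trans (_ : _ <= c' * (e / c')) _; last by rewrite mulrC divfK// gt_eqF.
    apply: le_trans (_ : _ <= c' * fine (mu (D k)) `^ r) _.
      rewrite ler_wpM2r ?powR_ge0//; apply: le_trans (ler_norm _) _.
      by rewrite lerDl.
    rewrite ler_wpM2l ?(ltW c'0)//.
    rewrite -[leRHS](@powRr1 _ (e / c')) ?divr_ge0 ?(ltW e0) ?(ltW c'0)//.
    rewrite -(mulVf (lt0r_neq0 r0)) powRrM ge0_ler_powR ?nnegrE ?(ltW r0)//.
      exact: fine_ge0.
    exact: powR_ge0.
  apply: near_eq_cvg; near=> k; rewrite nu_big// sumEFin big_mkord//.
have nu0' : (nu set0)%:E = 0%E by rewrite nu0.
pose m := isCharge.Build _ T R (fun A => (nu A)%:E) nu0' (fun _ _ => isT) nuS.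
pose nu' : {charge set T -> \bar R} := HB.pack (fun A => (nu A)%:E) m.
have nu_mu : nu' `<< mu.
  apply/null_content_dominatesP => A mA A0; rewrite /nu' /= nu_null//.
  by apply/eqP; rewrite -measure_le0 -A0 le_measure ?inE//; exact: measurableI.
exists (fine \o Radon_Nikodym nu' mu).
have RNfin x := Radon_Nikodym_fin_num x nu_mu.
split=> [|A mA].
  apply: eq_integrable (Radon_Nikodym_integrable nu_mu) => // x _.
  by rewrite /= fineK.
rewrite -[LHS]/(nu' A) (Radon_Nikodym_integral nu_mu mA); apply: eq_integral => x _.
by rewrite /= fineK.
Unshelve. all: by end_near. Qed.

(* Binary expansion: if 0 <= g <= 1 and A = {g >= 1/2}, then g = (1_A + g') / 2 with
   0 <= g' <= 1, so that L g = L g' / 2. *)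
Lemma linear_vanish_bounded d (T : measurableType d) (R : realType) (B : set T)
    (L : (T -> R) -> R) (c : R) :
  measurable B ->
  let X := [set g : T -> R | [/\ measurable_fun setT g, (forall x, ~ B x -> g x = 0)
    & exists M, forall x, `|g x| <= M]] in
  (forall (a : R) g h, X g -> X h -> L (fun x => a * g x + h x) = a * L g + L h) ->
  (forall A, measurable A -> A `<=` B -> L (\1_A) = 0) ->
  (forall g, X g -> (forall x, 0 <= g x <= 1) -> `|L g| <= c) ->
  forall g, X g -> L g = 0.
Proof.
move=> mB X Llin L1 Lc.
have X0 : X (cst 0).
  by split => //; exists 0 => x; rewrite normr0.
have XD (a : R) g h : X g -> X h -> X (fun x => a * g x + h x).
  move=> [mg gB [M gM]] [mh hB [M' hM']]; split.
  - by apply: measurable_funD => //; exact: measurable_funM.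
  - by move=> x Bx; rewrite gB// hB// mulr0 addr0.
  - exists (`|a| * M + M') => x; apply: le_trans (ler_normD _ _) _.
    by rewrite normrM lerD// ler_wpM2l.
have X1 A : measurable A -> A `<=` B -> X (\1_A).
  move=> mA AB; split; first exact: measurable_indic.
  - by move=> x Bx; rewrite indicE memNset// => /AB.
  - by exists 1 => x; rewrite indicE; case: (_ \in _); rewrite ?normr1 ?normr0.
have LZ (a : R) g : X g -> L (fun x => a * g x) = a * L g.
  move=> Xg; have L0 : L (cst 0) = 0.
    have /eqP := Llin 1 _ _ X0 X0; rewrite (_ : (fun x => _) = cst 0).
      by rewrite mul1r -subr_eq0 opprD addNKr oppr_eq0 => /eqP.
    by apply/funext => x; rewrite /= mulr0 addr0.
  have := Llin a _ _ Xg X0; rewrite L0 addr0 => <-; congr L.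
  by apply/funext => x; rewrite /= addr0.
have bis m : forall g, X g -> (forall x, 0 <= g x <= 1) -> `|L g| <= c / 2 ^+ m.
  elim: m => [|m IH] g Xg g01; first by rewrite expr0 divr1; exact: Lc.
  have [mg gB _] := Xg.
  pose A := [set x | 2^-1 <= g x].
  have mA : measurable A.
    rewrite -[X in measurable X]setTI (_ : A = g @^-1` `[2^-1, +oo[); first exact: mg.
    by apply/seteqP; split => x; rewrite /A /= in_itv/= andbT.
  have AB : A `<=` B.
    by move=> x Ax; apply: contrapT => /gB gx; move: Ax; rewrite /A /= gx; lra.
  pose g' x := 2 * g x + - 1 * \1_A x.
  have Xg' : X g'.
    apply: (XD) => //.
    rewrite (_ : (fun x => _) = (fun x => -1 * \1_A x + cst 0 x)); last first.
      by apply/funext => x; rewrite /= addr0.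
    by apply: (XD) => //; exact: X1.
  have g'01 x : 0 <= g' x <= 1.
    have := g01 x; rewrite /g' indicE => /andP[? ?].
    have [/set_mem|] := boolP (x \in A); rewrite /A /= ?notin_setE /= => ?; first by lra.
    by have [] := ltP (g x) 2^-1 => // ?; lra.
  have -> : L g = 2^-1 * L g'.
    rewrite /g' (Llin 2 g (fun x => -1 * \1_A x) Xg).
      by rewrite LZ ?L1 ?mulr0 ?addr0 ?mulKf//; exact: X1.
    have := XD (-1) _ _ (X1 A mA AB) X0; congr X.
    by apply/funext => x; rewrite /= addr0.
  rewrite normrM gtr0_norm ?invr_gt0// exprS invfM mulrCA ler_wpM2l ?invr_ge0//.
  exact: IH.
have L01 g : X g -> (forall x, 0 <= g x <= 1) -> L g = 0.
  move=> Xg g01; apply/eqP; rewrite -normr_le0; apply/ler_addgt0Pr => e e0; rewrite add0r.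
  have c0 : 0 <= c by apply: le_trans (Lc _ Xg g01).
  (* Then 2^(m+1) > m + 1 > c / e. *)
  pose m := Num.truncn (c / e).
  apply: le_trans (bis m.+1 g Xg g01) _; rewrite ler_pdivrMr ?exprn_gt0//.
  rewrite -ler_pdivrMl// mulrC; apply: le_trans (ltW (truncnS_gt _)) _.
  by rewrite -natrX ler_nat; apply: ltnW; exact: ltn_expl.
move=> g Xg; have [mg gB [M gM]] := Xg.
pose N := `|M| + 1.
have N0 : 0 < N by rewrite ltr_wpDl.
have gN x : `|g x| <= N.
  by apply: le_trans (gM x) _; apply: le_trans (ler_norm _) _; rewrite lerDl.
have Xp (s : R) : `|s| = 1 -> X (fun x => Num.max 0 (s * g x / N)).
  move=> s1; split.
  - apply: measurable_maxr => //; apply: measurable_funM => //; exact: measurable_funM.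
  - by move=> x /gB ->; rewrite mulr0 mul0r maxxx.
  - exists 1 => x; rewrite ger0_norm ?le_max ?lexx// ge_max ler01/=.
    apply: le_trans (ler_norm _) _; rewrite !normrM s1 mul1r normfV (gtr0_norm N0).
    by rewrite ler_pdivrMr// mul1r.
have p01 (s : R) x : `|s| = 1 -> 0 <= Num.max 0 (s * g x / N) <= 1.
  move=> s1; rewrite le_max lexx/= ge_max ler01/=.
  apply: le_trans (ler_norm _) _; rewrite !normrM s1 mul1r normfV (gtr0_norm N0).
  by rewrite ler_pdivrMr// mul1r.
have n1 : `|1 : R| = 1 by rewrite normr1.
have n1' : `|-1 : R| = 1 by rewrite normrN1.
(* Positive and negative parts of g, scaled into [0, 1] by N. *)
have -> : g = (fun x => N * Num.max 0 (1 * g x / N) + - N * Num.max 0 (-1 * g x / N)).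
  apply/funext => x; pose y := g x / N.
  have -> : 1 * g x / N = y by rewrite mul1r.
  have -> : -1 * g x / N = - y by rewrite mulN1r mulNr.
  have -> : g x = N * y by rewrite mulrC divfK// gt_eqF.
  rewrite mulNr -mulrBr; congr (_ * _).
  by rewrite /Num.max; repeat (case: ifP); lra.
rewrite (Llin N _ (fun x => - N * Num.max 0 (-1 * g x / N)) (Xp 1 n1)).
  rewrite LZ; last exact: Xp.
  rewrite !L01 ?mulr0 ?addr0//; try exact: Xp; by move=> x; exact: p01.
have := XD (- N) _ _ (Xp (-1) n1') X0; congr X.
by apply/funext => x; rewrite /= addr0.
Qed.

Lemma ge0_integral_bigcup_le d (T : measurableType d) (R : realType)
    (mu : {measure set T -> \bar R}) (F : nat -> set T) (f : T -> \bar R) (c : \bar R) :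
  nondecreasing_seq F -> (forall k, measurable (F k)) -> measurable_fun setT f ->
  (forall x, 0 <= f x)%E -> (forall k, \int[mu]_(x in F k) f x <= c)%E ->
  (\int[mu]_(x in \bigcup_k F k) f x <= c)%E.
Proof.
move=> ndF mF mf f0 fc.
have mfD D : measurable_fun D f by exact: measurable_funS (@subsetT _ _) mf.
have ndu : nondecreasing_seq (fun k => \int[mu]_(x in F k) f x)%E.
  by apply: ge0_nondecreasing_set_nondecreasing_integral => // i; exact: mfD.
have cu := ge0_nondecreasing_set_cvg_integral ndF mF (fun i => mfD _) (fun i x _ => f0 x).
rewrite -(cvg_lim (@ereal_hausdorff _) (cu mu)).
rewrite (cvg_lim (@ereal_hausdorff _) (ereal_nondecreasing_cvgn ndu)).
by apply: ge_ereal_sup => _ [k _ <-].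
Qed.

(** * Choquet weights *)

(* What is used of Bessel capacities and of compact subsets of R^n.  The axiom
   [cpt_pos] ensures that [cap_normM] is not the supremum of the empty set, -oo. *)
Record capacity_space {d} {T : measurableType d} {R : realType}
    (mu : {measure set T -> \bar R}) (cap : set T -> \bar R) (cpt : set T -> Prop)
    : Prop := CapacitySpace {
  cap_ge0 : forall E, (0 <= cap E)%E ;
  cap_set0 : cap set0 = 0%E ;
  le_cap : forall A B, A `<=` B -> (cap A <= cap B)%E ;
  cap_null : forall E, cap E = 0%E -> measurable E /\ mu E = 0%E ;
  cpt_measurable : forall K, cpt K -> measurable K ;
  cpt_cap : forall K, cpt K -> (cap K < +oo)%E ;
  cpt_mu : forall K, cpt K -> (mu K < +oo)%E ;
  cpt_inner : forall E, measurable E -> exists K : nat -> set T,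
    [/\ forall k, cpt (K k), nondecreasing_seq K, \bigcup_k K k `<=` E &
      mu (E `\` \bigcup_k K k) = 0%E] ;
  cpt_exhaust : exists B : nat -> set T,
    [/\ forall k, cpt (B k), nondecreasing_seq B & \bigcup_k B k = setT] ;
  cpt_pos : exists K, cpt K /\ cap K != 0%E }.

Arguments cap_ge0 {d T R mu cap cpt}.
Arguments cap_set0 {d T R mu cap cpt}.
Arguments le_cap {d T R mu cap cpt}.
Arguments cap_null {d T R mu cap cpt}.
Arguments cpt_measurable {d T R mu cap cpt}.
Arguments cpt_cap {d T R mu cap cpt}.
Arguments cpt_mu {d T R mu cap cpt}.
Arguments cpt_inner {d T R mu cap cpt}.
Arguments cpt_exhaust {d T R mu cap cpt}.
Arguments cpt_pos {d T R mu cap cpt}.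

Section choquet_weights.
Context {d} {T : measurableType d} {R : realType}
  {mu : {sigma_finite_measure set T -> \bar R}} {cap : set T -> \bar R}
  {cpt : set T -> Prop}.
Local Open Scope ereal_scope.

(** Local integrability is left out: the first formula ranges over all these weights, while the
    N-norm imposes its own restriction through [adm]. *)
Definition choquet_weight (D : set T) (w : T -> \bar R) : Prop :=
  [/\ cap (~` D) = 0, measurable_fun D w, forall x, D x -> 0 <= w x &
    \int[lebesgue_measure]_(t in `]0%R, +oo[) cap [set x | D x /\ t%:E < w x] <= 1].

Definition cap_normM (p : R) (f : T -> R) : \bar R :=
  ereal_sup [set ((\int[mu]_(x in K) (`|f x| `^ p)%:E) / cap K) `^ p^-1
            | K in [set K | cpt K /\ cap K != 0]].

Context (cap_space : capacity_space mu cap cpt).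

Lemma choquet_weight_measurable D w : choquet_weight D w ->
  measurable D /\ mu (~` D) = 0.
Proof.
move=> [/(cap_null cap_space)[mD D0] _ _ _]; split => //.
by rewrite -(setCK D); exact: measurableC.
Qed.

(** An increasing sequence of compact subsets fills E up to a null set, and the capacity of each is
    at most that of E by monotonicity. *)
Lemma integral_le_cap (F : T -> \bar R) (M : R) :
  measurable_fun setT F -> (forall x, 0 <= F x) -> (0 <= M)%R ->
  (forall K, cpt K -> \int[mu]_(x in K) F x <= M%:E * cap K) ->
  forall E, measurable E -> \int[mu]_(x in E) F x <= M%:E * cap E.
Proof.
move=> mF F0 M0 FK E mE; have [K [cK ndK KE EK]] := cpt_inner cap_space E mE.
have mK k : measurable (K k) by exact: (cpt_measurable cap_space).
have mUK : measurable (\bigcup_k K k) by exact: bigcupT_measurable.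
have mFE : measurable_fun E F by exact: measurable_funS mF.
rewrite (ge0_negligible_integral (measurableD mE mUK) mE mFE (fun x _ => F0 x) EK).
rewrite setDD setIidr//.
apply: ge0_integral_bigcup_le => // k; apply: le_trans (FK _ (cK k)) _.
rewrite lee_wpmul2l ?lee_fin//; apply: (le_cap cap_space).
by apply: subset_trans KE; exact: bigcup_sup.
Qed.

Lemma weighted_integral_le (F : T -> \bar R) (M : R) D w :
  measurable_fun setT F -> (forall x, 0 <= F x) -> (0 <= M)%R ->
  (forall K, cpt K -> \int[mu]_(x in K) F x <= M%:E * cap K) ->
  choquet_weight D w -> \int[mu]_(x in D) (F x * w x) <= M%:E.
Proof.
move=> mF F0 M0 FK Dw; have [mD _] := choquet_weight_measurable D w Dw.
have [_ mw w0 w1] := Dw.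
have [mI ->] := layer_cake _ T R mu D F w mD mF F0 mw w0.
have mcap : measurable_fun (`]0%R, +oo[%classic : set R)
    (fun t : R => cap [set x | D x /\ t%:E < w x]).
  apply: measurable_funTS; apply: nonincreasing_measurable => a b ab.
  apply: (le_cap cap_space) => x /= [Dx]; split => //.
  by apply: le_lt_trans b0; rewrite lee_fin.
apply: (@le_trans _ _ (\int[lebesgue_measure]_(t in `]0%R, +oo[)
    (M%:E * cap [set x | D x /\ t%:E < w x]))).
  apply: ge0_le_integral => //.
  - by move=> t _; exact: integral_ge0.
  - exact: emeasurable_funM.
  move=> t _; apply: integral_le_cap => //.
  exact: emeasurable_fun_o_infty.
rewrite ge0_integralZl//; last by move=> t _; exact: (cap_ge0 cap_space).
by rewrite -[leRHS]mule1 lee_wpmul2l ?lee_fin.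
Qed.

(** {w > t} is K for t < 1/c and empty afterwards, so the Choquet integral is cap K / c. Allowing
    any c >= cap K covers compact sets of zero capacity. *)
Lemma indic_choquet_weight K (c : R) : cpt K -> (0 < c)%R -> cap K <= c%:E ->
  choquet_weight setT (fun x => (c^-1 * \1_K x)%:E).
Proof.
move=> cK c0 Kc; have mK := cpt_measurable cap_space K cK.
split.
- by rewrite setCT (cap_set0 cap_space).
- apply/measurable_EFinP; apply: measurable_funM => //; exact: measurable_indic.
- by move=> x _; rewrite lee_fin mulr_ge0// invr_ge0 ltW.
rewrite (_ : \int[_]_(t in _) _ = \int[lebesgue_measure]_(t in `]0%R, (c^-1)%R[) cap K);
  last first.
  rewrite [LHS]integral_mkcond [RHS]integral_mkcond; apply: eq_integral => t _.
  have memI (I : interval R) : (t \in [set` I]) = (t \in I).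
    by apply/idP/idP => [/set_mem//|?]; exact/mem_set.
  rewrite !patchE !memI !in_itv/= andbT; have [t0|//] := ltP 0%R t.
  have [tc|ct]/= := ltP t c^-1%R.
    congr cap; apply/seteqP; split => x /=.
      move=> [_]; rewrite lte_fin indicE; case: (boolP (x \in K)) => [/set_mem//|_].
      by rewrite mulr0 ltNge ltW.
    by move=> Kx; split => //; rewrite lte_fin indicE mem_set// mulr1.
  rewrite -[RHS](cap_set0 cap_space); congr cap; apply/seteqP; split => x //= [_].
  rewrite lte_fin indicE; case: (_ \in _); rewrite ?mulr1 ?mulr0.
    by rewrite ltNge ct.
  by rewrite ltNge ltW.
rewrite integral_cst//= lebesgue_measure_itv/= lte_fin invr_gt0 c0 sube0.
apply: le_trans (_ : _ <= c%:E * c^-1%:E) _; last by rewrite -EFinM divff ?gt_eqF.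
by rewrite lee_wpmul2r// lee_fin invr_ge0 ltW.
Qed.

Lemma integral_indic_weight (F : T -> \bar R) K (c : R) :
  measurable_fun setT F -> (forall x, 0 <= F x) -> cpt K -> (0 < c)%R ->
  \int[mu]_x (F x * (c^-1 * \1_K x)%:E) = \int[mu]_(x in K) F x * c^-1%:E.
Proof.
move=> mF F0 cK c0; have mK := cpt_measurable cap_space K cK.
rewrite -ge0_integralZr//; last 2 first.
- exact: measurable_funTS.
- by rewrite lee_fin invr_ge0 ltW.
rewrite [RHS]integral_mkcond; apply: eq_integral => x _; rewrite patchE indicE.
by case: ifP => _; rewrite ?mulr1// mulr0 mule0.
Qed.

End choquet_weights.
Arguments choquet_weight {d T R} cap D w.
Arguments cap_normM {d T R} mu cap cpt p f.

Lemma measurable_norm_powR d (T : measurableType d) (R : realType) (p : R)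
    {f : T -> R} : measurable_fun setT f ->
  measurable_fun setT (fun x => (`|f x| `^ p)%:E).
Proof.
move=> mf; apply/measurable_EFinP.
apply: (measurableT_comp (measurable_powR p)).
exact: measurableT_comp.
Qed.
Arguments measurable_norm_powR {d T R} p {f}.

Lemma conjugate_exponent_gt1 (R : realType) (p q : R) :
  1 < p -> p^-1 + q^-1 = 1 -> 1 < q.
Proof.
move=> p1 pq; have p0 : 0 < p by exact: lt_trans p1.
have pi0 : 0 < p^-1 by rewrite invr_gt0.
have pi1 : p^-1 < 1 by rewrite invf_lt1.
have q0 : 0 < q by rewrite -invr_gt0; move: pq pi1; lra.
by rewrite -invf_lt1//; move: pq pi0; lra.
Qed.

(** * Weighted Hoelder inequality and the first formula *)

Section poweR_inequalities.
Context {R : realType}.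
Local Open Scope ereal_scope.
Implicit Types (x y w : \bar R) (a b p q : R).

Lemma poweR_invr_le x a p : 0 <= x -> (0 <= a)%R -> (0 < p)%R ->
  (x `^ p^-1 <= a%:E) = (x <= (a `^ p)%:E).
Proof.
move=> x0 a0 p0; have p0' : (0 <= p)%R := ltW p0.
have pi0 : (0 <= p^-1)%R by rewrite invr_ge0.
apply/idP/idP => h.
  have := gt0_ler_poweR p0' _ _ h; rewrite -poweRrM mulVf ?gt_eqF// poweRe1//; apply.
    by rewrite in_itv/= poweR_ge0 leey.
  by rewrite in_itv/= lee_fin a0 leey.
have := gt0_ler_poweR pi0 _ _ h;
  rewrite [in X in _ <= X]poweR_EFin -powRrM mulfV ?gt_eqF// powRr1//; apply.
  by rewrite in_itv/= x0 leey.
by rewrite in_itv/= lee_fin powR_ge0 leey.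
Qed.

(** Young's inequality for (a/al) w^(1/p) and (b/be) w^(-1/p), multiplied by al be; the second power
    is w^(1-q) because q/p = q - 1. The scaling is such that, once the two integrals are bounded by
    al^p and be^q, the right side integrates to at most al be (1/p + 1/q) = al be. *)
Lemma young_weight w a b al be p q : 0 <= w -> (0 <= a)%R -> (0 <= b)%R ->
  (0 < al)%R -> (0 < be)%R -> (1 < p)%R -> (p^-1 + q^-1 = 1)%R ->
  (a * b)%:E <=
  (al * be / (al `^ p * p))%:E * ((a `^ p)%:E * w) +
  (al * be / (be `^ q * q))%:E * ((b `^ q)%:E * (w `^ (q - 1))^-1).
Proof.
move=> w0 a0 b0 al0 be0 p1 pq.
have p0 : (0 < p)%R by exact: lt_trans p1.
have q1 : (1 < q)%R by exact: (conjugate_exponent_gt1 _ p q).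
have q0 : (0 < q)%R by exact: lt_trans q1.
have q10 : (q - 1 != 0)%R by rewrite subr_eq0 gt_eqF.
have c1 : (0 < al * be / (al `^ p * p))%R by rewrite divr_gt0 ?mulr_gt0 ?powR_gt0.
have c2 : (0 < al * be / (be `^ q * q))%R by rewrite divr_gt0 ?mulr_gt0 ?powR_gt0.
have t10 : 0 <= (al * be / (al `^ p * p))%:E * ((a `^ p)%:E * w).
  by rewrite mule_ge0 ?lee_fin ?(ltW c1)// mule_ge0// lee_fin powR_ge0.
have t20 : 0 <= (al * be / (be `^ q * q))%:E * ((b `^ q)%:E * (w `^ (q - 1))^-1).
  by rewrite mule_ge0 ?lee_fin ?(ltW c2)// mule_ge0 ?inve_ge0 ?poweR_ge0// lee_fin powR_ge0.
move: a0; rewrite le_eqVlt => /predU1P[a0|a0].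
  by rewrite -a0 mul0r; apply: adde_ge0 => //; move: t10; rewrite -a0.
move: b0; rewrite le_eqVlt => /predU1P[b0|b0].
  by rewrite -b0 mulr0; apply: adde_ge0 => //; move: t20; rewrite -b0.
(* With a and b positive, the first term is +oo for w = +oo and the second is +oo for w = 0, so only
   positive finite w remain. *)
case: w w0 t10 t20 => [w|w0|//]; last first.
  by rewrite !gt0_muley ?lte_fin ?powR_gt0// => _ t20;
    rewrite addye ?leey// gt_eqF// (lt_le_trans _ t20)// ltNy0.
rewrite lee_fin le_eqVlt => /predU1P[<-|w0] t10 t20.
  rewrite poweR0r// inve0 !gt0_muley ?lte_fin ?powR_gt0//.
  by rewrite !mule0 add0e leey.
rewrite poweR_EFin inver gt_eqF ?powR_gt0// -!EFinM -EFinD lee_fin.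
have X0 : (0 <= a / al * w `^ p^-1)%R by rewrite mulr_ge0 ?powR_ge0// divr_ge0 ?ltW.
have Y0 : (0 <= b / be * w `^ (- p^-1))%R by rewrite mulr_ge0 ?powR_ge0// divr_ge0 ?ltW.
have := conjugate_powR X0 Y0 p0 q0 pq.
have -> : (a / al * w `^ p^-1 * (b / be * w `^ (- p^-1)) = a * b / (al * be))%R.
  rewrite powRN; have := powR_gt0 p^-1 w0 => /gt_eqF/negbT; set z := (w `^ p^-1)%R => z0.
  by field; rewrite z0 !gt_eqF.
have divP (x y r : R) : (0 < x)%R -> (0 < y)%R -> ((x / y) `^ r = x `^ r / y `^ r)%R.
  move=> x0 y0; rewrite powRM ?invr_ge0 ?ltW//; congr (_ * _)%R.
  by rewrite -powR_inv1 ?ltW// -powRrM mulN1r powRN.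
have -> : ((a / al * w `^ p^-1) `^ p = a `^ p / al `^ p * w)%R.
  rewrite powRM ?powR_ge0 ?divr_ge0 ?ltW// divP//.
  by rewrite -powRrM mulVf ?gt_eqF// powRr1// ltW.
have -> : ((b / be * w `^ (- p^-1)) `^ q = b `^ q / be `^ q / w `^ (q - 1))%R.
  rewrite powRM ?powR_ge0 ?divr_ge0 ?ltW// divP//; congr (_ * _)%R.
  rewrite -powRrM -powRN; congr (_ `^ _)%R.
  have -> : (p^-1 = 1 - q^-1)%R by move: pq; lra.
  by rewrite mulNr mulrBl mul1r mulVf// gt_eqF.
rewrite ler_pdivrMr ?mulr_gt0// => /le_trans; apply.
rewrite le_eqVlt; apply/orP; left; apply/eqP.
have /gt_eqF/negbT alp := powR_gt0 p al0; have /gt_eqF/negbT beq := powR_gt0 q be0.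
have /gt_eqF/negbT wq := powR_gt0 (q - 1) w0.
have {}p0 := gt_eqF p0; have {}q0 := gt_eqF q0.
set u := (al `^ p)%R; set v := (be `^ q)%R.
by field; rewrite ?p0 ?q0 ?alp ?beq ?wq.
Qed.

End poweR_inequalities.

Section choquet_norms.
Context {d} {T : measurableType d} {R : realType}
  {mu : {sigma_finite_measure set T -> \bar R}} {cap : set T -> \bar R}
  {cpt : set T -> Prop}.
Context (cap_space : capacity_space mu cap cpt).
Local Open Scope ereal_scope.

Definition cap_sup_weighted (p : R) (f : T -> R) : \bar R :=
  ereal_sup [set (\int[mu]_(x in Dw.1) ((`|f x| `^ p)%:E * Dw.2 x)) `^ p^-1
            | Dw in [set Dw | choquet_weight cap Dw.1 Dw.2]].

Let Fp0 (p : R) (f : T -> R) x : 0 <= (`|f x| `^ p)%:E.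
Proof. by rewrite lee_fin powR_ge0. Qed.

Lemma cap_normM_ge0 p f : 0 <= cap_normM mu cap cpt p f.
Proof.
have [K [cK K0]] := cpt_pos cap_space.
apply: le_trans (poweR_ge0 _ _) _; apply: ereal_sup_ubound; exists K => //.
Qed.

(** Compact sets of zero capacity do not occur in the supremum; on them both sides vanish, because
    such sets are null. *)
Lemma cap_normM_le p f (a : R) : (0 < p)%R -> measurable_fun setT f -> (0 <= a)%R ->
  cap_normM mu cap cpt p f <= a%:E ->
  forall K, cpt K -> \int[mu]_(x in K) (`|f x| `^ p)%:E <= (a `^ p)%:E * cap K.
Proof.
move=> p0 mf a0 fa K cK; have [K0|K0] := eqVneq (cap K) 0.
  have [mK muK] := cap_null cap_space K K0.
  rewrite (ge0_negligible_integral mK mK _ _ muK)//;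
    last exact: measurable_funTS (measurable_norm_powR p mf).
  by rewrite setDv integral_set0 K0 mule0.
have : (\int[mu]_(x in K) (`|f x| `^ p)%:E / cap K) `^ p^-1 <= a%:E.
  by apply: le_trans fa; apply: ereal_sup_ubound; exists K.
have cK0 : 0 < cap K by rewrite lt_def K0 (cap_ge0 cap_space).
have := cpt_cap cap_space K cK; case: (cap K) K0 cK0 => [c| |]// c1 c0 _.
rewrite inver; move: c1; rewrite eqe => /negbTE ->.
rewrite poweR_invr_le//; first by rewrite lee_pdivrMr.
by apply: mule_ge0; [exact: integral_ge0|rewrite lee_fin invr_ge0 ltW].
Qed.

Lemma cap_normM_sup_weighted p f : (0 < p)%R -> measurable_fun setT f ->
  cap_normM mu cap cpt p f = cap_sup_weighted p f.
Proof.
move=> p0 mf; apply/eqP; rewrite eq_le; apply/andP; split.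
  apply: ge_ereal_sup => _ [K [cK K0] <-].
  have cK0 : 0 < cap K by rewrite lt_def K0 (cap_ge0 cap_space).
  have Koo := cpt_cap cap_space K cK.
  have KE : cap K = (fine (cap K))%:E by rewrite fineK// ge0_fin_numE// ltW.
  have c0 : (0 < fine (cap K))%R by rewrite -lte_fin -KE.
  apply: ereal_sup_ubound; exists (setT, fun x => ((fine (cap K))^-1 * \1_K x)%:E) => /=.
    by apply: (indic_choquet_weight cap_space) => //; rewrite -KE.
  rewrite (integral_indic_weight cap_space _ _ _ (measurable_norm_powR p mf) (Fp0 p f) cK c0).
  by rewrite [in RHS]KE inver gt_eqF.
apply: ge_ereal_sup => _ [[D w] /= Dw <-].
have [foo|] := ltP (cap_normM mu cap cpt p f) +oo; last first.
  by rewrite leye_eq => /eqP ->; rewrite leey.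
have fE : cap_normM mu cap cpt p f = (fine (cap_normM mu cap cpt p f))%:E.
  by rewrite fineK// ge0_fin_numE// cap_normM_ge0.
have a0 : (0 <= fine (cap_normM mu cap cpt p f))%R by rewrite fine_ge0// cap_normM_ge0.
rewrite fE poweR_invr_le//; last first.
  by apply: integral_ge0 => x Dx; rewrite mule_ge0//; have [_ _ ->] := Dw.
apply: (weighted_integral_le cap_space) => //.
- exact: measurable_norm_powR.
- exact: powR_ge0.
- by apply: cap_normM_le => //; rewrite -fE.
Qed.

Lemma weighted_hoelder (p q al be : R) (f g : T -> R) D w :
  (1 < p)%R -> (p^-1 + q^-1 = 1)%R -> (0 < al)%R -> (0 < be)%R ->
  measurable_fun setT f -> measurable_fun setT g -> choquet_weight cap D w ->
  \int[mu]_(x in D) ((`|f x| `^ p)%:E * w x) <= (al `^ p)%:E ->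
  \int[mu]_(x in D) ((`|g x| `^ q)%:E * (w x `^ (q - 1))^-1) <= (be `^ q)%:E ->
  \int[mu]_x `|f x * g x|%:E <= (al * be)%:E.
Proof.
move=> p1 pq al0 be0 mf mg Dw fa gb.
have [mD D0] := choquet_weight_measurable cap_space D w Dw.
have [_ mw w0 _] := Dw.
have mfg : measurable_fun setT (fun x => `|f x * g x|%:E).
  by apply/measurable_EFinP; apply: measurableT_comp => //; exact: measurable_funM.
have p0 : (0 < p)%R by exact: lt_trans p1.
have q0 : (0 < q)%R.
  by apply: lt_trans ltr01 _; exact: (conjugate_exponent_gt1 _ p q).
have c1 : (0 <= al * be / (al `^ p * p))%R.
  by rewrite ltW// divr_gt0 ?mulr_gt0 ?powR_gt0.
have c2 : (0 <= al * be / (be `^ q * q))%R.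
  by rewrite ltW// divr_gt0 ?mulr_gt0 ?powR_gt0.
rewrite (ge0_negligible_integral (measurableC mD) measurableT mfg _ D0)//.
rewrite setTD setCK.
pose u x := (`|f x| `^ p)%:E * w x.
pose v x := (`|g x| `^ q)%:E * (w x `^ (q - 1))^-1.
have mu_ : measurable_fun D u.
  by apply: emeasurable_funM => //; exact: measurable_funTS (measurable_norm_powR p mf).
have mv : measurable_fun D v.
  apply: emeasurable_funM; first exact: measurable_funTS (measurable_norm_powR q mg).
  apply: measurable_fun_inve => [|x _]; last exact: poweR_ge0.
  exact: (measurableT_comp (measurable_poweR (q - 1)) mw).
have u0 x : D x -> 0 <= u x by move=> Dx; rewrite mule_ge0// w0.
have v0 x : D x -> 0 <= v x by move=> Dx; rewrite mule_ge0// inve_ge0 poweR_ge0.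
apply: (@le_trans _ _ (\int[mu]_(x in D) ((al * be / (al `^ p * p))%:E * u x +
    (al * be / (be `^ q * q))%:E * v x))).
  apply: ge0_le_integral => //.
  - exact: measurable_funTS mfg.
  - by apply: emeasurable_funD; exact: measurable_funeM.
  - by move=> x Dx; rewrite normrM; apply: young_weight => //; exact: w0.
rewrite ge0_integralD//; last 4 first.
- by move=> x Dx; rewrite mule_ge0 ?lee_fin ?u0.
- exact: measurable_funeM.
- by move=> x Dx; rewrite mule_ge0 ?lee_fin ?v0.
- exact: measurable_funeM.
rewrite !ge0_integralZl_EFin//.
apply: (@le_trans _ _ ((al * be / (al `^ p * p))%:E * (al `^ p)%:E +
    (al * be / (be `^ q * q))%:E * (be `^ q)%:E)).
  by apply: leeD; rewrite lee_wpmul2l ?lee_fin.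
rewrite -!EFinM -EFinD lee_fin le_eqVlt; apply/orP; left; apply/eqP.
have /gt_eqF/negbT := powR_gt0 p al0; have /gt_eqF/negbT := powR_gt0 q be0.
set x := (be `^ q)%R; set y := (al `^ p)%R => x0 y0.
transitivity (al * be * (p^-1 + q^-1))%R; last by rewrite pq mulr1.
by field; rewrite x0 y0 !gt_eqF.
Qed.

End choquet_norms.
Arguments cap_sup_weighted {d T R} mu cap p f.

(** * Duality *)

Section test_function.
Context {d} {T : measurableType d} {R : realType}.
Implicit Types (f : T -> R) (E : set T) (p q : R).

(* sgn(f) |f|^(p-1) 1_E, the equality case of Hoelder's inequality *)
Definition test_fun p f E : T -> R := fun x => f x * `|f x| `^ (p - 2) * \1_E x.

Lemma measurable_test_fun p f E : measurable_fun setT f -> measurable E ->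
  measurable_fun setT (test_fun p f E).
Proof.
move=> mf mE; apply: measurable_funM; last exact: measurable_indic.
apply: measurable_funM => //; apply: (measurableT_comp (measurable_powR (p - 2))).
exact: measurableT_comp.
Qed.

Lemma mul_test_fun p f E x : 0 < p -> f x * test_fun p f E x = `|f x| `^ p * \1_E x.
Proof.
move=> p0; rewrite /test_fun !mulrA; congr (_ * _).
have [->|f0] := eqVneq (f x) 0; first by rewrite !mul0r normr0 powR0// gt_eqF.
rewrite -expr2 -(real_normK (num_real (f x))) -powR_mulrn// -powRD ?normr_eq0 ?(negbTE
  f0) ?implybT//.
by congr (_ `^ _); ring.
Qed.

(** Zeros of f are separated because [powR] has value 1 at base 0 and exponent 0: for p = 1 the test
    function is the sign of f, which is 0 there. *)
Lemma norm_test_fun p f E x : `|test_fun p f E x| =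
  (if f x == 0 then 0 else `|f x| `^ (p - 1)) * \1_E x.
Proof.
rewrite /test_fun normrM [X in _ * X]ger0_norm ?indicE//; congr (_ * _).
have [->|f0] := eqVneq (f x) 0; first by rewrite mul0r normr0.
rewrite normrM [X in _ * X]ger0_norm ?powR_ge0// -{1}(powRr1 (normr_ge0 (f x))).
rewrite -powRD ?normr_eq0 ?(negbTE f0) ?implybT//.
by congr (_ `^ _); ring.
Qed.

Lemma norm_test_fun_powR p q f E x : 0 < p -> 0 < q -> (p - 1) * q = p ->
  `|test_fun p f E x| `^ q = `|f x| `^ p * \1_E x.
Proof.
move=> p0 q0 pq; rewrite norm_test_fun indicE; case: (_ \in _); last first.
  by rewrite !mulr0 powR0// gt_eqF.
rewrite !mulr1; have [->|f0] := eqVneq (f x) 0; last by rewrite -powRrM pq.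
by rewrite normr0 !powR0// gt_eqF.
Qed.

Lemma test_fun_out p f E x : ~ E x -> test_fun p f E x = 0.
Proof. by move=> Ex; rewrite /test_fun indicE memNset// mulr0. Qed.

End test_function.

(** Since (q-1)/q = 1/p, the hypothesis reads A <= o c^(1/p) A^(1/q). Dividing by A^(1/q), which
    requires A to be finite and positive, and raising to the power p gives the claim. *)
Lemma dual_exponent_bound (R : realType) (p q o c A : R) :
  1 < p -> p^-1 + q^-1 = 1 -> 0 <= o -> 0 < c -> 0 <= A ->
  A <= o * (c `^ (q - 1) * A) `^ q^-1 -> A <= o `^ p * c.
Proof.
move=> p1 pq o0 c0; rewrite le_eqVlt => /predU1P[<- _|A0 AA].
  by rewrite mulr_ge0 ?powR_ge0 ?ltW.
have p0 : 0 < p by exact: lt_trans p1.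
have q0 : 0 < q.
  by apply: lt_trans ltr01 _; exact: (conjugate_exponent_gt1 _ p q).
have E : (c `^ (q - 1) * A) `^ q^-1 = c `^ p^-1 * A `^ q^-1.
  rewrite powRM ?powR_ge0 ?ltW// -powRrM; congr (_ `^ _ * _).
  by rewrite mulrBl mul1r mulfV ?gt_eqF//; move: pq; lra.
have Ap : A `^ p^-1 <= o * c `^ p^-1.
  rewrite -(@ler_pM2r _ (A `^ q^-1)) ?powR_gt0//.
  rewrite -powRD; last by rewrite (gt_eqF A0) implybT.
  by rewrite pq (powRr1 (ltW A0)) -mulrA -E.
have Ap0 : A `^ p^-1 \in Num.nneg by rewrite nnegrE powR_ge0.
have oc0 : o * c `^ p^-1 \in Num.nneg by rewrite nnegrE mulr_ge0 ?powR_ge0.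
have := ge0_ler_powR (ltW p0) Ap0 oc0 Ap.
by rewrite powRM ?powR_ge0// -!powRrM mulVf ?(gt_eqF p0)// (powRr1 (ltW A0)) (powRr1 (ltW c0)).
Qed.

Section duality.
Context {d} {T : measurableType d} {R : realType}
  {mu : {sigma_finite_measure set T -> \bar R}} {cap : set T -> \bar R}
  {cpt : set T -> Prop}.
Context (cap_space : capacity_space mu cap cpt).
(** The duality holds for every class [adm] of weights between the normalised indicators of compact
    sets and all Choquet weights. In the application it consists of the locally integrable ones. *)
Context (adm : set T -> (T -> \bar R) -> Prop) (p q : R).
Hypothesis p1 : 1 < p.
Hypothesis pq : p^-1 + q^-1 = 1.
Hypothesis adm_weight : forall D w, adm D w -> choquet_weight cap D w.
Hypothesis adm_indic : forall K (c : R), cpt K -> 0 < c -> (cap K <= c%:E)%E ->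
  adm setT (fun x => (c^-1 * \1_K x)%:E).
Local Open Scope ereal_scope.
Implicit Types (f g h : T -> R) (K E : set T).

Definition cap_normN (g : T -> R) : \bar R :=
  ereal_inf [set (\int[mu]_(x in Dw.1)
                    ((`|g x| `^ q)%:E * (Dw.2 x `^ (q - 1))^-1)) `^ q^-1
            | Dw in [set Dw | adm Dw.1 Dw.2]].

Definition cap_spaceN : set (T -> R) :=
  [set g : T -> R | measurable_fun setT g /\ cap_normN g < +oo].

Definition cap_spaceM : set (T -> R) :=
  [set f : T -> R | (measurable_fun setT f /\
    forall K, cpt K -> \int[mu]_(x in K) (`|f x| `^ p)%:E < +oo) /\
    cap_normM mu cap cpt p f < +oo].

Definition cap_pairing f g : R := (\int[mu]_x (f x * g x))%R.

Let p0 : (0 < p)%R. Proof. exact: lt_trans p1. Qed.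

Let q1 : (1 < q)%R. Proof. exact: (conjugate_exponent_gt1 _ p q). Qed.

Let q0 : (0 < q)%R. Proof. exact: lt_trans q1. Qed.

Let pqE : ((p - 1) * q = p)%R.
Proof.
have -> : (p - 1 = p * q^-1)%R.
  have -> : (q^-1 = 1 - p^-1)%R by move: pq; lra.
  by rewrite mulrBr mulr1 mulfV// gt_eqF.
by rewrite -mulrA mulVf ?mulr1// gt_eqF.
Qed.

Let pow0 (r : R) (g : T -> R) x : 0 <= (`|g x| `^ r)%:E.
Proof. by rewrite lee_fin powR_ge0. Qed.

Lemma cap_normN_ge0 g : 0 <= cap_normN g.
Proof. by apply: le_ereal_inf_tmp => _ [Dw _ <-]; exact: poweR_ge0. Qed.

(** Take the weight 1_K / c, for which w^(1-q) = c^(q-1) on K. Off K it is +oo, but g vanishes there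
    and 0 times +oo is 0. *)
Lemma cap_normN_le_cpt K (c : R) g : cpt K -> (0 < c)%R -> cap K <= c%:E ->
  measurable_fun setT g -> (forall x, ~ K x -> g x = 0%R) ->
  cap_normN g <= ((c `^ (q - 1))%:E * \int[mu]_x (`|g x| `^ q)%:E) `^ q^-1.
Proof.
move=> cK c0 Kc mg gK; apply: ereal_inf_lbound.
exists (setT, fun x => (c^-1 * \1_K x)%:E) => /=; first exact: adm_indic.
congr (_ `^ _); rewrite -ge0_integralZl_EFin ?powR_ge0//; last exact: measurable_norm_powR.
apply: eq_integral => x _; rewrite indicE.
case: (boolP (x \in K)) => [_|]; last first.
  by rewrite notin_setE => /gK ->; rewrite normr0 powR0 ?gt_eqF// mul0e mule0.
have ci : (0 < c^-1)%R by rewrite invr_gt0.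
rewrite mulr1 inver gt_eqF ?powR_gt0// muleC; congr (_%:E * _).
by rewrite -powR_inv1 ?ltW// -powRrM mulN1r powRN invrK.
Qed.

Lemma cap_normN_cpt_lty K g : cpt K -> measurable_fun setT g ->
  (forall x, ~ K x -> g x = 0%R) -> \int[mu]_x (`|g x| `^ q)%:E < +oo ->
  cap_normN g < +oo.
Proof.
move=> cK mg gK goo.
have Kfin : cap K \is a fin_num.
  by rewrite ge0_fin_numE ?(cap_ge0 cap_space)// (cpt_cap cap_space).
have c0 : (0 < fine (cap K) + 1)%R.
  by rewrite ltr_wpDl// fine_ge0// (cap_ge0 cap_space).
have Kc : cap K <= (fine (cap K) + 1)%:E by rewrite -{1}(fineK Kfin) lee_fin lerDl.
apply: le_lt_trans (cap_normN_le_cpt K _ g cK c0 Kc mg gK) _.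
by apply: poweR_lty; rewrite lte_mul_pinfty// ?lee_fin ?powR_ge0.
Qed.

Lemma bounded_cpt_lty K g (M : R) : cpt K -> measurable_fun setT g ->
  (forall x, ~ K x -> g x = 0%R) -> (forall x, (`|g x| <= M)%R) ->
  \int[mu]_x (`|g x| `^ q)%:E <= (M `^ q)%:E * mu K.
Proof.
move=> cK mg gK gM; have mK := cpt_measurable cap_space K cK.
rewrite -(integral_cst mu mK) [leRHS]integral_mkcond; apply: ge0_le_integral => //.
- exact: measurable_norm_powR.
- by apply/(measurable_restrictT _ mK).
move=> x _; rewrite patchE; case: ifPn => [_|]; last first.
  by rewrite notin_setE => /gK ->; rewrite normr0 powR0// gt_eqF.
by rewrite lee_fin ge0_ler_powR ?nnegrE ?(ltW q0)// (le_trans _ (gM x)).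
Qed.

Lemma cap_spaceN_bounded K g (M : R) : cpt K -> measurable_fun setT g ->
  (forall x, ~ K x -> g x = 0%R) -> (forall x, (`|g x| <= M)%R) -> cap_spaceN g.
Proof.
move=> cK mg gK gM; split => //; apply: (cap_normN_cpt_lty K) => //.
apply: le_lt_trans (bounded_cpt_lty K g M cK mg gK gM) _.
by rewrite lte_mul_pinfty ?lee_fin ?powR_ge0// (cpt_mu cap_space).
Qed.

(** The infimum defining the N-norm need not be attained, so Hoelder's inequality is applied for
    each be above it; be = N(g) + e/al costs an error e. *)
Lemma cap_pairing_le f g (al : R) : (0 < al)%R -> measurable_fun setT f ->
  cap_normM mu cap cpt p f <= al%:E -> cap_spaceN g ->
  mu.-integrable setT (EFin \o (fun x => f x * g x)%R) /\
  `|cap_pairing f g|%:E <= al%:E * cap_normN g.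
Proof.
move=> al0 mf fal [mg goo].
have mfg : measurable_fun setT (fun x => (f x * g x)%R) by exact: measurable_funM.
have bound (be : R) : cap_normN g < be%:E -> \int[mu]_x `|f x * g x|%:E <= (al * be)%:E.
  move=> gbe; have be0 : (0 < be)%R by rewrite -lte_fin (le_lt_trans (cap_normN_ge0 g)).
  have /ereal_inf_lt[_ [[D w] /= /adm_weight Dw <-] gw] := gbe.
  apply: (weighted_hoelder cap_space _ _ _ _ _ _ _ _ p1 pq al0 be0 mf mg Dw).
    apply: (weighted_integral_le cap_space) => //.
    - exact: measurable_norm_powR.
    - exact: powR_ge0.
    - by apply: (cap_normM_le cap_space) => //; exact: ltW.
  have := ltW gw; rewrite poweR_invr_le// ?(ltW be0)//.
  by apply: integral_ge0 => x Dx; rewrite mule_ge0// inve_ge0 poweR_ge0.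
have gfin : cap_normN g \is a fin_num by rewrite ge0_fin_numE// cap_normN_ge0.
have ifg : mu.-integrable setT (EFin \o (fun x => f x * g x)%R).
  apply/integrableP; split; first exact/measurable_EFinP.
  apply: (le_lt_trans (bound (fine (cap_normN g) + 1)%R _)); last exact: ltry.
  by rewrite -{1}(fineK gfin) lte_fin ltrDl.
split => //; rewrite -(fineK gfin).
have fg_le : `|cap_pairing f g|%:E <= \int[mu]_x `|f x * g x|%:E.
  rewrite /cap_pairing /Rintegral.
  have fin := integrable_fin_num measurableT ifg.
  rewrite -[leLHS]/(`|(fine (\int[mu]_x (f x * g x)%:E))%:E|) fineK//.
  by apply: le_abse_integral => //; exact/measurable_EFinP.
apply/lee_addgt0Pr => e e0; apply: le_trans fg_le _.
apply: le_trans (bound (fine (cap_normN g) + e / al)%R _) _.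
  by rewrite -{1}(fineK gfin) lte_fin ltrDl divr_gt0.
by rewrite -EFinM -EFinD lee_fin mulrDr (mulrC al (e / al)%R) divfK// gt_eqF.
Qed.

Lemma cap_spaceM_bound f : cap_spaceM f -> exists2 al : R, (0 < al)%R &
  cap_normM mu cap cpt p f <= al%:E.
Proof.
move=> [_ foo].
have ffin : cap_normM mu cap cpt p f \is a fin_num.
  by rewrite ge0_fin_numE// (cap_normM_ge0 cap_space).
exists (fine (cap_normM mu cap cpt p f) + 1)%R.
  by rewrite ltr_wpDl// fine_ge0// (cap_normM_ge0 cap_space).
by rewrite -{1}(fineK ffin) lee_fin lerDl.
Qed.

Lemma cap_pairing_integrable f g : cap_spaceM f -> cap_spaceN g ->
  mu.-integrable setT (EFin \o (fun x => f x * g x)%R).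
Proof.
move=> Mf Ng; have [al al0 fal] := cap_spaceM_bound f Mf.
by have [] := cap_pairing_le f g al al0 Mf.1.1 fal Ng.
Qed.

Lemma cap_pairing_dual f : cap_spaceM f -> dual cap_spaceN cap_normN (cap_pairing f).
Proof.
move=> Mf; split => [a g h Ng Nh|]; last first.
  have [al al0 fal] := cap_spaceM_bound f Mf.
  by exists al => g Ng; have [] := cap_pairing_le f g al al0 Mf.1.1 fal Ng.
have ig := cap_pairing_integrable f g Mf Ng; have ih := cap_pairing_integrable f h Mf Nh.
rewrite /cap_pairing -RintegralZl// -RintegralD//; last first.
  by apply: eq_integrable (integrableZl measurableT a ig) => // x _; rewrite /= EFinM.
by apply: eq_Rintegral => x _; ring.
Qed.

Lemma cap_pairing_linear (a : R) f1 f2 g : cap_spaceM f1 -> cap_spaceM f2 ->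
  cap_spaceN g ->
  cap_pairing (fun x => a * f1 x + f2 x)%R g = (a * cap_pairing f1 g + cap_pairing f2 g)%R.
Proof.
move=> M1 M2 Ng.
have i1 := cap_pairing_integrable f1 g M1 Ng; have i2 := cap_pairing_integrable f2 g M2 Ng.
rewrite /cap_pairing -RintegralZl// -RintegralD//; last first.
  by apply: eq_integrable (integrableZl measurableT a i1) => // x _; rewrite /= EFinM.
by apply: eq_Rintegral => x _; ring.
Qed.

(** Testing with the sign of f1 - f2 on B k gives the integral of |f1 - f2| over B k. *)
Lemma cap_pairing_inj f1 f2 : cap_spaceM f1 -> cap_spaceM f2 ->
  (forall g, cap_spaceN g -> cap_pairing f1 g = cap_pairing f2 g) ->
  {ae mu, forall x, f1 x = f2 x}.
Proof.
move=> M1 M2 f12; have [B [cB ndB BT]] := cpt_exhaust cap_space.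
have mB k : measurable (B k) by exact: (cpt_measurable cap_space).
pose u x := (f1 x - f2 x)%R.
have mu_ : measurable_fun setT u by apply: measurable_funB; [exact: M1.1.1|exact: M2.1.1].
pose g k := test_fun 1 u (B k).
have mg k : measurable_fun setT (g k) by exact: measurable_test_fun.
have Ng k : cap_spaceN (g k).
  apply: (cap_spaceN_bounded (B k) _ 1) => // x.
    exact: test_fun_out.
  rewrite norm_test_fun subrr powRr0 indicE.
  by case: ifP => _; case: (_ \in _); rewrite ?mulr0 ?mul0r ?mulr1 ?ler01.
have i0 k : \int[mu]_(x in B k) `|(u x)%:E| = 0.
  have i1 := cap_pairing_integrable f1 (g k) M1 (Ng k).
  have i2 := cap_pairing_integrable f2 (g k) M2 (Ng k).
  have : (cap_pairing f1 (g k) - cap_pairing f2 (g k) = 0)%R by rewrite f12// subrr.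
  rewrite /cap_pairing -RintegralB// => ug.
  rewrite integral_mkcond (eq_integral (fun x => (f1 x * g k x - f2 x * g k x)%:E)); last first.
    move=> x _; rewrite -mulrBl -/(u x) /g mul_test_fun// powRr1// patchE indicE.
    by case: ifP => _; rewrite ?mulr1 ?mulr0.
  rewrite -[RHS]/(0%R%:E) -ug /Rintegral fineK//.
  apply: integrable_fin_num => //.
  by apply: eq_integrable (integrableB measurableT i1 i2) => // x _.
have h k : mu.-negligible (B k `&` [set x | u x != 0%R]).
  have /ae_eq_integral_abs := i0 k.
  move=> /(_ (mB k) (measurable_funTS ((measurable_EFinP _ _).2 mu_))).
  apply: negligibleS => x [Bx ux] /= /(_ Bx) [u0].
  by move: ux; rewrite /= u0 eqxx.
apply: negligibleS (negligible_bigcup h) => x /= fx.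
have [k _ Bx] : (\bigcup_k B k) x by rewrite BT.
by exists k => //; split => //=; apply/eqP => /eqP; rewrite subr_eq0 => /eqP.
Qed.

(** Hoelder's inequality gives one direction, with norm + e in place of the norm because
    [cap_pairing_le] wants a positive constant. For the other, each compact K of positive capacity
    is tested with a normalised [test_fun]. *)
Lemma opnorm_cap_pairing f : cap_spaceM f ->
  opnorm cap_spaceN cap_normN (cap_pairing f) = cap_normM mu cap cpt p f.
Proof.
move=> Mf; have [[mf floc] foo] := Mf.
have ffin : cap_normM mu cap cpt p f \is a fin_num.
  by rewrite ge0_fin_numE// (cap_normM_ge0 cap_space).
apply/eqP; rewrite eq_le; apply/andP; split.
  apply: ge_ereal_sup => _ [g [Ng g1] <-].
  rewrite -(fineK ffin); apply/lee_addgt0Pr => e e0.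
  have al0 : (0 < fine (cap_normM mu cap cpt p f) + e)%R.
    by rewrite ltr_wpDl// fine_ge0// (cap_normM_ge0 cap_space).
  have fal : cap_normM mu cap cpt p f <= (fine (cap_normM mu cap cpt p f) + e)%:E.
    by rewrite -{1}(fineK ffin) lee_fin lerDl ltW.
  have [_ fg] := cap_pairing_le f g _ al0 mf fal Ng.
  apply: le_trans fg _; rewrite -EFinD -[leRHS]mule1 lee_wpmul2l// lee_fin ltW//.
apply: ge_ereal_sup => _ [K [cK K0] <-].
set o := opnorm _ _ _.
have ub g : cap_spaceN g -> cap_normN g <= 1 -> `|cap_pairing f g|%:E <= o.
  by move=> Ng g1; apply: ereal_sup_ubound; exists g.
have mK := cpt_measurable cap_space K cK.
have KE : cap K = (fine (cap K))%:E.
  by rewrite fineK// ge0_fin_numE ?(cap_ge0 cap_space)// (cpt_cap cap_space).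
set c := fine (cap K) in KE.
have c0 : (0 < c)%R by rewrite -lte_fin -KE lt_def K0 (cap_ge0 cap_space).
have AE : \int[mu]_(x in K) (`|f x| `^ p)%:E = (fine (\int[mu]_(x in K) (`|f x| `^ p)%:E))%:E.
  by rewrite fineK// ge0_fin_numE ?floc// integral_ge0.
have A0 : (0 <= fine (\int[mu]_(x in K) (`|f x| `^ p)%:E))%R.
  by rewrite fine_ge0// integral_ge0.
rewrite KE AE; set A := fine (integral _ _ _) in AE A0 *.
rewrite inver gt_eqF// -EFinM.
have [oo|] := ltP o +oo; last by rewrite leye_eq => /eqP ->; rewrite leey.
have N0 : cap_spaceN (cst 0%R).
  by apply: (cap_spaceN_bounded K _ 0) => // x; rewrite normr0.
have o0 : 0 <= o.
  apply: le_trans (ub _ N0 _); first by rewrite lee_fin.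
  apply: le_trans (cap_normN_le_cpt K c _ cK c0 _ _ _) _ => //; first by rewrite KE.
  under eq_integral do rewrite normr0 powR0 ?gt_eqF//.
  by rewrite integral0 mule0 poweR0r// invr_eq0 gt_eqF.
have oE : o = (fine o)%:E by rewrite fineK// ge0_fin_numE.
have fo0 : (0 <= fine o)%R by rewrite fine_ge0.
rewrite oE poweR_invr_le ?lee_fin ?divr_ge0 ?(ltW c0)// ler_pdivrMr//.
apply: (dual_exponent_bound _ p q) => //.
move: A0; rewrite le_eqVlt => /predU1P[<-|A0].
  by rewrite mulr0 powR0 ?mulr0// gt_eqF// invr_gt0.
(* b is the bound of [cap_normN_le_cpt] for the N-norm of [test_fun p f K]; dividing by it puts g in
   the unit ball, while the pairing becomes A / b. *)
pose b := ((c `^ (q - 1) * A) `^ q^-1)%R.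
have b0 : (0 < b)%R by rewrite powR_gt0// mulr_gt0// powR_gt0.
have bq : (b `^ q = c `^ (q - 1) * A)%R.
  by rewrite /b -powRrM mulVf ?gt_eqF// powRr1// mulr_ge0 ?powR_ge0 ?ltW.
pose g x := (b^-1 * test_fun p f K x)%R.
have mg : measurable_fun setT g.
  by apply: measurable_funM => //; exact: measurable_test_fun.
have gK x : ~ K x -> g x = 0%R by move=> Kx; rewrite /g test_fun_out// mulr0.
have gqE : \int[mu]_x (`|g x| `^ q)%:E = ((b `^ q)^-1 * A)%:E.
  rewrite (eq_integral (fun x => (b `^ q)^-1%:E * ((fun x => (`|f x| `^ p)%:E) \_ K) x)).
    rewrite ge0_integralZl_EFin ?invr_ge0 ?powR_ge0//.
    - by rewrite -integral_mkcond AE.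
    - by move=> x _; exact: erestrict_ge0.
    - by apply/(measurable_restrictT _ mK); exact: measurable_funTS (measurable_norm_powR p mf).
  move=> x _; rewrite /g normrM powRM// norm_test_fun_powR// patchE indicE.
  rewrite gtr0_norm ?invr_gt0// -powR_inv1 ?ltW// -powRrM mulN1r powRN.
  by case: ifP => _; rewrite ?mulr1 ?mulr0 ?mule0.
have Ng : cap_normN g <= 1.
  apply: le_trans (cap_normN_le_cpt K c _ cK c0 _ mg gK) _; first by rewrite KE.
  rewrite gqE -EFinM poweR_EFin lee_fin bq invfM mulrA.
  rewrite (_ : (_ * _)%R = 1%R) ?powR1//.
  have cq : (c `^ (q - 1) != 0)%R by rewrite gt_eqF// powR_gt0.
  by field; rewrite cq gt_eqF.
have Jo : (`|cap_pairing f g| <= fine o)%R.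
  by have := ub g (conj mg (le_lt_trans Ng (ltry _))) Ng; rewrite oE lee_fin.
rewrite -/b -ler_pdivrMr//; apply: le_trans Jo; apply: le_trans (_ : _ <= cap_pairing f g)%R _.
  rewrite le_eqVlt; apply/orP; left; apply/eqP.
  rewrite /cap_pairing /Rintegral (eq_integral (fun x => b^-1%:E * ((fun x => (`|f x| `^
    p)%:E) \_ K) x)).
    rewrite ge0_integralZl_EFin ?invr_ge0 ?(ltW b0)//.
    - by rewrite -integral_mkcond AE /= mulrC.
    - by move=> x _; exact: erestrict_ge0.
    - by apply/(measurable_restrictT _ mK); exact: measurable_funTS (measurable_norm_powR p mf).
  move=> x _; rewrite /g mulrCA mul_test_fun// patchE indicE.
  by case: ifP => _; rewrite ?mulr1 ?mulr0 ?mule0.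
exact: ler_norm.
Qed.

(** The weight belongs to the compact set K although the function lives on a smaller measurable set
    E, so truncations of f are still measured by the capacity of K. *)
Lemma cap_normN_test_fun f K E (c : R) : cpt K -> (0 < c)%R -> cap K <= c%:E ->
  measurable_fun setT f -> measurable E -> E `<=` K ->
  cap_normN (test_fun p f E) <=
    ((c `^ (q - 1))%:E * \int[mu]_(x in E) (`|f x| `^ p)%:E) `^ q^-1.
Proof.
move=> cK c0 Kc mf mE EK.
apply: le_trans (cap_normN_le_cpt K c _ cK c0 Kc _ _) _.
- exact: measurable_test_fun.
- by move=> x Kx; apply: test_fun_out => /EK.
rewrite [X in _ <= (_ * X) `^ _]integral_mkcond.
rewrite (eq_integral ((fun x => (`|f x| `^ p)%:E) \_ E))// => x _.
rewrite norm_test_fun_powR// patchE indicE.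
by case: ifP => _; rewrite ?mulr1 ?mulr0.
Qed.

Lemma cap_pairing_test_fun f E : measurable E ->
  (\int[mu]_(x in E) (`|f x| `^ p)%:E)%E \is a fin_num ->
  (cap_pairing f (test_fun p f E))%:E = \int[mu]_(x in E) (`|f x| `^ p)%:E.
Proof.
move=> mE fE; rewrite /cap_pairing /Rintegral.
rewrite (eq_integral ((fun x => (`|f x| `^ p)%:E) \_ E)).
  by rewrite -integral_mkcond fineK.
move=> x _; rewrite mul_test_fun// patchE indicE.
by case: ifP => _; rewrite ?mulr1 ?mulr0.
Qed.

(** A single weight with finite integral for g is admissible for all remainders, and the tails of
    that one integral tend to 0. *)
Lemma cap_normN_tail g (F : nat -> set T) (e : R) : cap_spaceN g ->
  nondecreasing_seq F -> (forall k, measurable (F k)) -> \bigcup_k F k = setT ->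
  (0 < e)%R -> exists k, cap_normN (fun x => g x * \1_(~` F k) x)%R <= e%:E.
Proof.
move=> [mg goo] ndF mF FT e0.
have /ereal_inf_lt[_ [[D w] /= aDw <-] gw] := goo.
have Dw := adm_weight _ _ aDw; have [mD _] := choquet_weight_measurable cap_space D w Dw.
have [_ mw w0 _] := Dw.
pose v x := (`|g x| `^ q)%:E * (w x `^ (q - 1))^-1.
have mv : measurable_fun D v.
  apply: emeasurable_funM; first exact: measurable_funTS (measurable_norm_powR q mg).
  apply: measurable_fun_inve => [|x _]; last exact: poweR_ge0.
  exact: (measurableT_comp (measurable_poweR (q - 1)) mw).
have v0 x : D x -> 0 <= v x by move=> Dx; rewrite mule_ge0// inve_ge0 poweR_ge0.
have voo : \int[mu]_x (v \_ D) x < +oo.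
  by rewrite -integral_mkcond; apply: lty_poweRy gw; rewrite invr_eq0 gt_eqF.
have eq0 : (0 < e `^ q)%R by exact: powR_gt0.
have mvD : measurable_fun setT (v \_ D) by apply/(measurable_restrictT _ mD).
have vD0 x : 0 <= (v \_ D) x by exact: erestrict_ge0.
have [k vk] := integral_tail _ _ _ mu (v \_ D) F (e `^ q) mvD vD0 voo ndF mF FT eq0.
exists k; apply: le_trans (_ : _ <= (\int[mu]_(x in ~` F k) (v \_ D) x) `^ q^-1) _; last first.
  by rewrite poweR_invr_le// ?(ltW e0)// integral_ge0.
apply: ereal_inf_lbound; exists (D, w) => //=; congr (_ `^ _).
rewrite [LHS]integral_mkcond [RHS]integral_mkcond; apply: eq_integral => x _.
rewrite !patchE indicE; case: (x \in D); last by rewrite if_same.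
case: (x \in _); first by rewrite mulr1.
by rewrite mulr0 normr0 powR0 ?gt_eqF// mul0e.
Qed.

Lemma dual_representation (L : (T -> R) -> R) : dual cap_spaceN cap_normN L ->
  exists2 f, cap_spaceM f & forall g, cap_spaceN g -> cap_pairing f g = L g.
Proof.
move=> [Llin [C0 LC0]].
pose C : R := `|C0|%R.
have LC g : cap_spaceN g -> `|L g|%:E <= C%:E * cap_normN g.
  move=> Ng; apply: le_trans (LC0 g Ng) _.
  by rewrite lee_wpmul2r ?cap_normN_ge0// lee_fin ler_norm.
have C_ge0 : (0 <= C)%R by exact: normr_ge0.
have [B [cB ndB BT]] := cpt_exhaust cap_space.
have mB k : measurable (B k) by exact: (cpt_measurable cap_space).
have muB k : mu (B k) < +oo by exact: (cpt_mu cap_space).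
have BE k : mu (B k) = (fine (mu (B k)))%:E by rewrite fineK// ge0_fin_numE.
pose c k : R := (fine (cap (B k)) + 1)%R.
have c_gt0 k : (0 < c k)%R by rewrite ltr_wpDl// fine_ge0// (cap_ge0 cap_space).
have Bc k : cap (B k) <= (c k)%:E.
  have Bfin : cap (B k) \is a fin_num.
    by rewrite ge0_fin_numE ?(cap_ge0 cap_space)// (cpt_cap cap_space).
  by rewrite -{1}(fineK Bfin) lee_fin lerDl.
(* Bounded functions supported in B k lie in N, and L is bounded on them in the norm of L^q; the
   constant [cc k] comes from the weight 1_(B k) / c k. *)
pose X k := [set g : T -> R | [/\ measurable_fun setT g,
   (forall x, ~ B k x -> g x = 0)%R & exists M, forall x, (`|g x| <= M)%R]].
have XN k g : X k g -> cap_spaceN g.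
  by move=> [mg gB [M gM]]; exact: (cap_spaceN_bounded (B k) g M).
pose cc k : R := (C * (c k `^ (q - 1)) `^ q^-1)%R.
have cc0 k : (0 <= cc k)%R by rewrite mulr_ge0// powR_ge0.
have L_le k g : X k g -> `|L g|%:E <= (cc k)%:E * (\int[mu]_x (`|g x| `^ q)%:E) `^ q^-1.
  move=> Xg; have [mg gB _] := Xg; apply: le_trans (LC g (XN _ _ Xg)) _.
  rewrite EFinM -muleA lee_wpmul2l// -poweR_EFin -poweRM ?lee_fin ?powR_ge0//.
    exact: (cap_normN_le_cpt (B k)).
  by apply: integral_ge0.
have X1 k A : measurable A -> X k (\1_(A `&` B k)).
  move=> mA; split.
  - by apply: measurable_indic; exact: measurableI.
  - by move=> x Bx; rewrite indicE memNset// => -[].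
  - by exists 1%R => x; rewrite indicE; case: (_ \in _); rewrite ?normr1 ?normr0.
have L1D A A' k : measurable A -> measurable A' -> A `&` A' = set0 ->
    L (\1_((A `|` A') `&` B k)) = (L (\1_(A `&` B k)) + L (\1_(A' `&` B k)))%R.
  move=> mA mA' AA'.
  rewrite -[X in (X + _)%R]mul1r -(Llin 1%R _ _ (XN _ _ (X1 k A mA)) (XN _ _ (X1 k A' mA'))).
  congr L; apply/funext => x; rewrite !indicE !in_setI in_setU mul1r.
  case: (boolP (x \in A)) => [/set_mem Ax|_] /=; last by rewrite add0r.
  rewrite (memNset (A := A')) /= ?addr0// => A'x.
  by have : (A `&` A') x by []; rewrite AA'.
have dens k : exists h : T -> R, mu.-integrable setT (EFin \o h) /\
    forall A, measurable A -> (L (\1_(A `&` B k)))%:E = \int[mu]_(x in A) (h x)%:E.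
  apply: (set_function_density _ _ _ mu (B k) _ (cc k) q^-1) => //.
  - by rewrite invr_gt0.
  - by move=> A A' mA mA' AA'; exact: L1D.
  move=> A mA; have mAB : measurable (A `&` B k) by exact: measurableI.
  have E1 : \int[mu]_x (`|\1_(A `&` B k) x : R| `^ q)%:E = (fine (mu (A `&` B k)))%:E.
    rewrite (eq_integral (fun x => (\1_(A `&` B k) x)%:E)); last first.
      move=> x _; rewrite indicE; case: (_ \in _); rewrite ?normr1 ?powR1//.
      by rewrite normr0 powR0// gt_eqF.
    rewrite integral_indic// setIT fineK// ge0_fin_numE//; apply: le_lt_trans (muB k).
    by rewrite le_measure ?inE//; exact: subIsetr.
  by have := L_le k _ (X1 k A mA); rewrite E1 poweR_EFin -EFinM lee_fin.
have {dens}[h hP] := choice dens.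
(* The density on B k is only used on the shell D k, so the densities need not be
   compared with each other. *)
pose D := seqD B.
have DB k : D k `<=` B k by case: k => // k; exact: subDsetl.
have mD k : measurable (D k) by case: k => [|k]; [exact: mB|exact: measurableD].
have DT x : exists k, D k x.
  have [k _ Dx] : (\bigcup_k D k) x by rewrite eq_bigcup_seqD BT.
  by exists k.
have [kx kxP] := choice DT.
have kxE k x : D k x -> kx x = k.
  move=> Dx; have /trivIsetP tD := trivIset_seqD ndB.
  apply/eqP; apply: contraT => kxk; have : (D (kx x) `&` D k) x by split => //; exact: kxP.
  by rewrite tD.
pose f x := h (kx x) x.
have mh k : measurable_fun setT (h k).
  by have [/integrableP[/measurable_EFinP]] := hP k.
have fE k x : D k x -> f x = h k x by move=> Dx; rewrite /f (kxE k x Dx).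
have mf : measurable_fun setT f.
  move=> _ Y mY; rewrite setTI.
  rewrite (_ : f @^-1` Y = \bigcup_k (D k `&` (h k @^-1` Y))).
    apply: bigcupT_measurable => k; apply: measurableI => //.
    by rewrite -[X in measurable X]setTI; exact: mh.
  apply/seteqP; split => [x Yx|x [k _ [Dx Yx]]].
    by exists (kx x) => //; split => //; exact: kxP.
  by rewrite /preimage /= (fE k x Dx).
have iD k A : measurable A -> mu.-integrable (A `&` D k) (EFin \o f) /\
    (L (\1_(A `&` D k)))%:E = \int[mu]_(x in A `&` D k) (f x)%:E.
  move=> mA; have mAD : measurable (A `&` D k) by exact: measurableI.
  have [ih Lh] := hP k.
  have fhE : {in A `&` D k, EFin \o h k =1 EFin \o f}.
    by move=> x /set_mem[_ Dx]; rewrite /= (fE k x Dx).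
  split.
    exact: (@eq_integrable _ _ _ mu _ mAD _ _ fhE (integrableS measurableT mAD (@subsetT
      _ _) ih)).
  have := Lh _ mAD; rewrite -setIA (setIidl (DB k)) => ->.
  exact: eq_integral.
(* The shells are added one at a time, so finite additivity of L on indicators suffices. *)
have iB k A : measurable A -> mu.-integrable (A `&` B k) (EFin \o f) /\
    (L (\1_(A `&` B k)))%:E = \int[mu]_(x in A `&` B k) (f x)%:E.
  elim: k A => [|k IH] A mA; first exact: (iD 0%N).
  have BS : B k.+1 = B k `|` D k.+1 by exact: setU_seqD.
  have [ik Lk] := IH A mA; have [iS LS] := iD k.+1 A mA.
  have dis : [disjoint A `&` B k & A `&` D k.+1].
    by apply/disj_setPS => x [[_ Bx] [_ [_ /(_ Bx)]]].
  have mAB : measurable (A `&` B k) by exact: measurableI.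
  have mAD : measurable (A `&` D k.+1) by exact: measurableI.
  have mfU S : measurable_fun S (EFin \o f).
    by apply: measurable_funTS; exact/measurable_EFinP.
  split.
    apply/integrableP; split => //; rewrite BS setIUr ge0_integral_setU//; last first.
      by apply: measurable_funTS; apply: measurableT_comp => //; exact/measurable_EFinP.
    by apply: lte_add_pinfty; [case/integrableP : ik|case/integrableP : iS].
  rewrite {2}BS setIUr integral_setU//.
  rewrite -Lk -LS -EFinD; congr EFin.
  have AS : A `&` B k.+1 = ((A `&` B k) `|` (A `&` D k.+1)) `&` B k.+1.
    by rewrite -setIUr -BS -setIA setIid.
  rewrite AS L1D//; last first.
    by apply/seteqP; split => // x [[_ Bx] [_ [_ /(_ Bx)]]].
  congr (L _ + L _)%R; congr (\1_ _).
    rewrite -setIA (setIidl (B := B k.+1))//; exact/subsetPset/ndB.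
  by rewrite -setIA (setIidl (B := B k.+1)).
have XM k g : X k g -> mu.-integrable setT (EFin \o (fun x => f x * g x)%R).
  move=> [mg gB [M gM]].
  have [ik _] := iB k setT measurableT; rewrite setTI in ik.
  apply: (@le_integrable _ _ _ mu setT measurableT _
     (fun x => M%:E * ((EFin \o f) \_ (B k)) x)).
  - by apply/measurable_EFinP; exact: measurable_funM.
  - move=> x _; rewrite patchE; case: ifPn => [_|].
      rewrite /= lee_fin !normrM mulrC ler_wpM2r//; apply: le_trans (gM x) _.
      exact: ler_norm.
    by rewrite notin_setE => /gB gx; rewrite /= gx mulr0 normr0 lee_fin normr_ge0.
  - by apply: integrableZl => //; apply/(integrable_mkcond _ (mB k)).
(* L and the pairing agree on indicators by [iB], and for 0 <= g <= 1 their difference is bounded by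
   a constant depending only on k, as [linear_vanish_bounded] requires. *)
have repr k g : X k g -> L g = cap_pairing f g.
  move=> Xg; apply/eqP; rewrite -subr_eq0; apply/eqP; move: g Xg.
  have [ik _] := iB k setT measurableT; rewrite setTI in ik.
  apply: (linear_vanish_bounded _ _ _ (B k) (fun g => L g - cap_pairing f g)%R
    (cc k * (fine (mu (B k))) `^ q^-1 + fine (\int[mu]_(x in B k) `|(EFin \o f) x|))%R (mB k)).
  - move=> a g g' Xg Xg'; rewrite (Llin a _ _ (XN _ _ Xg) (XN _ _ Xg')).
    rewrite (_ : cap_pairing f _ = a * cap_pairing f g + cap_pairing f g')%R; first by ring.
    have ig := XM k g Xg; have ig' := XM k g' Xg'.
    rewrite /cap_pairing -RintegralZl// -RintegralD//; last first.
      by apply: eq_integrable (integrableZl measurableT a ig) => // x _; rewrite /= EFinM.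
    by apply: eq_Rintegral => x _; ring.
  - move=> A mA AB; have [_ ] := iB k A mA; rewrite (setIidl AB) => LA.
    apply/eqP; rewrite subr_eq0 -eqe LA; apply/eqP; rewrite /cap_pairing /Rintegral.
    rewrite fineK; last first.
      by apply: (integrable_fin_num measurableT); apply: (XM k); rewrite -(setIidl AB);
        exact: X1.
    rewrite [LHS]integral_mkcond; apply: eq_integral => x _; rewrite patchE indicE.
    by case: ifP => _; rewrite ?mulr1 ?mulr0.
  move=> g Xg g01; apply: le_trans (ler_normB _ _) _; apply: lerD.
    rewrite -lee_fin EFinM; apply: le_trans (L_le k g Xg) _.
    rewrite lee_wpmul2l ?lee_fin// -poweR_EFin -BE.
    apply: gt0_ler_poweR; rewrite ?invr_ge0 ?(ltW q0)//.
    - by rewrite in_itv/= leey andbT integral_ge0.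
    - by rewrite in_itv/= leey andbT.
    have [mg gB _] := Xg.
    rewrite -[leRHS]mul1e -[1 in leRHS](poweR1r q); apply: bounded_cpt_lty => // x.
    by case/andP : (g01 x) => g0 g1; rewrite ger0_norm.
  have ig := XM k g Xg; have [mg gB _] := Xg.
  rewrite -lee_fin /cap_pairing /Rintegral -[leLHS]/(`|(fine _)%:E|).
  rewrite fineK; last exact: (integrable_fin_num measurableT ig).
  rewrite fineK; last first.
    rewrite ge0_fin_numE ?integral_ge0//; by case/integrableP : ik.
  apply: le_trans (le_abse_integral mu measurableT (measurable_int mu ig)) _.
  rewrite [leRHS]integral_mkcond; apply: ge0_le_integral => //.
  - by apply: measurableT_comp => //; exact: (measurable_int mu ig).
  - apply/(measurable_restrictT _ (mB k)); apply: measurable_funTS.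
    by apply: measurableT_comp => //; exact/measurable_EFinP.
  move=> x _; rewrite patchE; case: ifPn => [_|].
    rewrite /= lee_fin normrM; case/andP : (g01 x) => g0 g1.
    by rewrite ler_piMr// ger0_norm.
  by rewrite notin_setE => /gB /= ->; rewrite mulr0 normr0.
(* f is not yet known to be in L^p(K). On S k, where |f| <= k inside B k, the integral is finite, so
   [dual_exponent_bound] applies with a constant independent of k. As before, e >= cap K includes
   the case of zero capacity. *)
have test K (e : R) : cpt K -> (0 < e)%R -> cap K <= e%:E ->
    \int[mu]_(x in K) (`|f x| `^ p)%:E <= (C `^ p * e)%:E.
  move=> cK e0 Ke; have mK := cpt_measurable cap_space K cK.
  pose S k := K `&` (B k `&` [set x | (`|f x| <= k%:R)%R]).
  have mS k : measurable (S k).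
    apply: measurableI => //; apply: measurableI => //.
    rewrite -[X in measurable X]setTI.
    rewrite (_ : [set x | _] = (fun x => `|f x|%R) @^-1` `]-oo, k%:R]%classic); last first.
      by apply/seteqP; split => x /=; rewrite in_itv.
    have : measurable_fun setT (fun x => `|f x|%R) by exact: measurableT_comp.
    exact.
  have KS : K = \bigcup_k S k.
    apply/seteqP; split => [x Kx|x [k _ []]//].
    have [k _ Bx] : (\bigcup_k B k) x by rewrite BT.
    exists (maxn k (Num.truncn `|f x|%R).+1) => //; split => //; split => /=.
      by have /subsetPset := ndB _ _ (leq_maxl k (Num.truncn `|f x|%R).+1); apply.
    by apply: ltW; apply: lt_le_trans (truncnS_gt _) _; rewrite ler_nat leq_maxr.
  rewrite KS; apply: ge0_integral_bigcup_le => //.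
  - move=> i j ij; rewrite subsetEset; apply: setIS; apply: setISS.
      exact/subsetPset/ndB.
    by move=> x /= /le_trans; apply; rewrite ler_nat.
  - exact: measurable_norm_powR.
  move=> k.
  have SK : S k `<=` K by exact: subIsetl.
  have Xt : X k (test_fun p f (S k)).
    split; first exact: measurable_test_fun.
      by move=> x Bx; apply: test_fun_out => -[_ []].
    exists (k%:R `^ (p - 1))%R => x; rewrite norm_test_fun indicE.
    case: (boolP (x \in S k)) => [/set_mem[_ [_ /= fk]]|_]; last first.
      by rewrite mulr0 powR_ge0.
    rewrite mulr1; case: ifP => _; first exact: powR_ge0.
    by rewrite ge0_ler_powR ?nnegrE// subr_ge0 ltW.
  have fin : \int[mu]_(x in S k) (`|f x| `^ p)%:E \is a fin_num.
    rewrite ge0_fin_numE ?integral_ge0//.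
    apply: (@le_lt_trans _ _ (\int[mu]_(x in S k) (k%:R `^ p)%:E)).
      apply: ge0_le_integral => //; first exact: measurable_funTS (measurable_norm_powR p mf).
      by move=> x [_ [_ /= fk]]; rewrite lee_fin ge0_ler_powR ?nnegrE// ltW.
    rewrite integral_cst// lte_mul_pinfty ?lee_fin ?powR_ge0//.
    apply: le_lt_trans (muB k); rewrite le_measure ?inE//.
    by move=> x [_ []].
  have := LC _ (XN _ _ Xt); rewrite (repr k _ Xt) => AL.
  have LA := cap_pairing_test_fun f (S k) (mS k) fin.
  set A := cap_pairing _ _ in AL LA; rewrite -LA lee_fin.
  have A0 : (0 <= A)%R by rewrite -lee_fin LA integral_ge0.
  apply: (dual_exponent_bound _ p q) => //; rewrite -lee_fin.
  move: AL; rewrite ger0_norm// => /le_trans; apply; rewrite EFinM lee_wpmul2l//.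
  by apply: le_trans (cap_normN_test_fun f K (S k) e cK e0 Ke mf (mS k) SK) _; rewrite -LA.
have Mf : cap_spaceM f.
  split; first split => //.
    move=> K cK.
    have Kfin : cap K \is a fin_num.
      by rewrite ge0_fin_numE ?(cap_ge0 cap_space)// (cpt_cap cap_space).
    have e0 : (0 < fine (cap K) + 1)%R.
      by rewrite ltr_wpDl// fine_ge0// (cap_ge0 cap_space).
    apply: (le_lt_trans (test K _ cK e0 _)); last exact: ltry.
    by rewrite -{1}(fineK Kfin) lee_fin lerDl.
  apply: (@le_lt_trans _ _ C%:E); last exact: ltry.
  apply: ge_ereal_sup => _ [K [cK K0] <-].
  have KE : cap K = (fine (cap K))%:E.
    by rewrite fineK// ge0_fin_numE ?(cap_ge0 cap_space)// (cpt_cap cap_space).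
  have k0 : (0 < fine (cap K))%R by rewrite -lte_fin -KE lt_def K0 (cap_ge0 cap_space).
  rewrite KE inver gt_eqF// poweR_invr_le//; last first.
    by rewrite mule_ge0 ?integral_ge0// lee_fin invr_ge0 ltW.
  by rewrite lee_pdivrMr// -EFinM; apply: test => //; rewrite -KE.
exists f => // g Ng.
have [al al0 fal] := cap_spaceM_bound f Mf.
(* On F k the function g is bounded with support in B k, where L is already represented; what is
   left is small in N by [cap_normN_tail]. *)
pose F k := B k `&` [set x | (`|g x| <= k%:R)%R].
have [mg _] := Ng.
have mF k : measurable (F k).
  apply: measurableI => //; rewrite -[X in measurable X]setTI.
  rewrite (_ : [set x | _] = (fun x => `|g x|%R) @^-1` `]-oo, k%:R]%classic); last first.
    by apply/seteqP; split => x /=; rewrite in_itv.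
  have : measurable_fun setT (fun x => `|g x|%R) by exact: measurableT_comp.
  exact.
have ndF : nondecreasing_seq F.
  move=> i j ij; rewrite subsetEset; apply: setISS.
    exact/subsetPset/ndB.
  by move=> x /= /le_trans; apply; rewrite ler_nat.
have FT : \bigcup_k F k = setT.
  apply/seteqP; split => // x _.
  have [k _ Bx] : (\bigcup_k B k) x by rewrite BT.
  exists (maxn k (Num.truncn `|g x|%R).+1) => //; split => /=.
    by have /subsetPset := ndB _ _ (leq_maxl k (Num.truncn `|g x|%R).+1); apply.
  by apply: ltW; apply: lt_le_trans (truncnS_gt _) _; rewrite ler_nat leq_maxr.
apply/eqP; rewrite -subr_eq0 -normr_le0; apply/ler_addgt0Pr => e e0; rewrite add0r.
(* The remainder enters once through the pairing, with constant al, and once through L, with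
   constant C. *)
have e0' : (0 < e / (al + C))%R by rewrite divr_gt0// ltr_wpDr.
have [k Nk] := cap_normN_tail g F _ Ng ndF mF FT e0'.
set r := (fun x => _) in Nk.
have Nr : cap_spaceN r.
  split; last by apply: le_lt_trans Nk _; exact: ltry.
  by apply: measurable_funM => //; apply: measurable_indic; exact: measurableC.
pose gk x := (g x * \1_(F k) x)%R.
have Xk : X k gk.
  split.
  - by apply: measurable_funM => //; exact: measurable_indic.
  - by move=> x Bx; rewrite /gk indicE memNset ?mulr0// => -[].
  - exists k%:R => x; rewrite /gk indicE; case: (boolP (x \in F k)) => [/set_mem[_ //]|_].
      by rewrite mulr1.
    by rewrite mulr0 normr0.
have gE : g = (fun x => 1 * gk x + r x)%R.
  apply/funext => x; rewrite /gk /r mul1r -mulrDr !indicE in_setC.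
  by case: (_ \in _); rewrite ?addr0 ?add0r mulr1.
have -> : (cap_pairing f g - L g = cap_pairing f r - L r)%R.
  have [plin _] := cap_pairing_dual f Mf.
  rewrite gE (Llin 1%R _ _ (XN _ _ Xk) Nr) (plin 1%R _ _ (XN _ _ Xk) Nr).
  by rewrite (repr k _ Xk); ring.
apply: le_trans (ler_normB _ _) _; rewrite -lee_fin EFinD.
have [_ pr] := cap_pairing_le f r al al0 mf fal Nr.
apply: le_trans (leeD pr (LC r Nr)) _.
have al0' : 0 <= al%:E by rewrite lee_fin ltW.
have C0' : 0 <= C%:E by rewrite lee_fin.
apply: le_trans (leeD (lee_wpmul2l al0' Nk) (lee_wpmul2l C0' Nk)) _.
by rewrite -!EFinM -EFinD lee_fin -mulrDl mulrC divfK// gt_eqF// ltr_wpDr.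
Qed.

End duality.

(** * The Bessel capacity as a capacity space *)

Lemma integral_indic_lty d (T : measurableType d) (R : realType)
    (mu : {measure set T -> \bar R}) (A D : set T) (c : R) :
  0 <= c -> measurable A -> measurable D -> (mu D < +oo)%E ->
  (\int[mu]_(x in D) `|(c * \1_A x)%:E| < +oo)%E.
Proof.
move=> c0 mA mD Doo.
apply: (@le_lt_trans _ _ (c%:E * mu D)%E); last by rewrite lte_mul_pinfty ?lee_fin.
rewrite -(integral_cst mu mD); apply: ge0_le_integral => //.
  apply: measurable_funTS; apply: measurableT_comp => //.
  by apply/measurable_EFinP; apply: measurable_funM => //; exact: measurable_indic.
move=> x _; rewrite /= lee_fin indicE normrM (ger0_norm c0).
by case: (_ \in _); rewrite ?normr1 ?mulr1 ?normr0 ?mulr0.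
Qed.

Lemma integral_null_space d (T : measurableType d) (R : realType)
    (mu : {measure set T -> \bar R}) (f : T -> \bar R) :
  measurable_fun setT f -> mu setT = 0%E -> (\int[mu]_x f x = 0)%E.
Proof.
move=> mf T0; apply/eqP; rewrite -abse_eq0 eq_le abse_ge0 andbT.
rewrite -(integral_abs_eq0 measurableT mf T0).
exact: le_abse_integral.
Qed.

(** [inner_regular] needs bounded sets, so it is applied in the cube of radius k with error 1/(k+1);
    finite unions make the sequence increasing. On a fixed cube m, all indices beyond m contribute,
    so the error tends to 0. *)
Lemma compact_inner_approximation (R : realType) (n : nat) (E : set (Rn R n)) :
  measurable E -> exists K : nat -> set (Rn R n),
    [/\ forall k, compact (K k), nondecreasing_seq K, \bigcup_k K k `<=` E &
      leb (E `\` \bigcup_k K k) = 0%E].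
Proof.
move=> mE.
have /choice[K' K'P] : forall k : nat, exists K : set (Rn R n),
    [/\ compact K, K `<=` E `&` cube k%:R &
      (leb ((E `&` cube k%:R) `\` K) <= (k.+1%:R^-1)%:E)%E].
  move=> k; apply: (@inner_regular R n (E `&` cube k%:R) (k.+1%:R^-1)).
  - by rewrite invr_gt0 ltr0n.
  - exact: (measurableI _ _ mE (measurable_cube _)).
  - by exists k%:R; exact: subIsetr.
pose K k := \big[setU/set0]_(i < k) K' i.
have cK k : compact (K k).
  rewrite /K; elim: k => [|k IH]; first by rewrite big_ord0; exact: compact0.
  rewrite big_ord_recr /=; apply: compactU => //; by have [] := K'P k.
have KE : \bigcup_k K k `<=` E.
  move=> x [k _]; rewrite /K -bigcup_mkord => -[i _ Kx].
  by have [_ /(_ _ Kx)[]] := K'P i.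
exists K; split => //.
  by move=> i j ij; rewrite subsetEset; exact: subset_bigsetU.
have EK m : leb ((E `&` cube m%:R) `\` \bigcup_k K k) = 0%E.
  apply/eqP; rewrite eq_le outer_measure_ge0 andbT; apply/lee_addgt0Pr => e e0.
  rewrite add0e.
  have [k ke] : exists k : nat, k.+1%:R^-1 < e.
    by have [k /=] := ltr_add_invr e0; rewrite add0r; exists k.
  have [_ _ Kk] := K'P (maxn m k).
  apply: le_trans (le_outer_measure _ _ _ (_ : _ `<=` (E `&` cube (maxn m k)%:R) `\` K'
    (maxn m k))) _.
    move=> x [[Ex mx] nK]; split; last first.
      move=> Kx; apply: nK; exists (maxn m k).+1 => //.
      by rewrite /K -bigcup_mkord; exists (maxn m k) => /=.
    by split => //; apply: subset_cube mx; rewrite ler_nat leq_maxl.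
  apply: le_trans Kk _; rewrite lee_fin; apply: le_trans (ltW ke).
  by rewrite lef_pV2 ?posrE ?ltr0n// ler_nat ltnS leq_maxr.
apply/eqP; rewrite eq_le outer_measure_ge0 andbT.
rewrite -(setIT (E `\` _)) -cube_exhaust setI_bigcupr.
apply: le_trans (outer_measure_sigma_subadditive _ _) _.
rewrite eseries0// => k _ _; apply/eqP; rewrite eq_le outer_measure_ge0 andbT -(EK k).
by apply: le_outer_measure => x [[Ex nK] kx].
Qed.

Section bessel_capacity_space.
Context {R : realType} {n : nat}.
Local Notation mu := (@leb R n).
Context (alpha s : R) (G : Rn R n -> R).
Hypothesis s1 : 1 < s.
Hypothesis GP : bessel_kernel alpha G.

Lemma bessel_capacity_space : capacity_space mu (capacity G s) compact.
Proof.
have [iG G1] := bessel_kernel_integral alpha G GP.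
have s0 : 0 < s by exact: lt_trans s1.
have null E : capacity G s E = 0%E -> measurable E /\ mu E = 0%E.
  move=> /(capacity0_null G s E iG (ltW s1)) E0; split => //.
  exact: leb_null_measurable.
split.
- exact: capacity_ge0.
- exact: capacity_set0.
- exact: le_capacity.
- exact: null.
- exact: measurable_compact.
- by move=> K; exact: (capacity_compact_lty G s K iG G1 s0).
- exact: leb_compact_lty.
- exact: compact_inner_approximation.
- exists (fun k => cube k%:R); split.
  + by move=> k; exact: compact_cube.
  + by move=> i j ij; rewrite subsetEset; apply: subset_cube; rewrite ler_nat.
  + exact: cube_exhaust.
(* If every compact set had zero capacity, all cubes and hence the whole space would be null,
   contradicting that G has integral 1. *)
apply: contrapT => noK.
have cube0 k : mu (cube k%:R) = 0%E.
  have [] // := null (cube k%:R); apply/eqP; apply: contrapT => /negP k0.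
  by apply: noK; exists (cube k%:R); split => //; exact: compact_cube.
have T0 : mu setT = 0%E.
  apply/eqP; rewrite eq_le outer_measure_ge0 andbT -cube_exhaust.
  apply: le_trans (outer_measure_sigma_subadditive _ _) _.
  by rewrite eseries0// => k _ _; exact: cube0.
have /integrableP[mG _] := iG.
have := integral_null_space _ _ _ mu _ mG T0.
by rewrite G1 => /eqP; rewrite onee_eq0.
Qed.

Definition bessel_admissible (D : set (Rn R n)) (w : Rn R n -> \bar R) : Prop :=
  [/\ qe_weight G s D w, L1_loc_on D w & (choquet G s D w <= 1)%E].

Lemma bessel_admissible_weight D w : bessel_admissible D w ->
  choquet_weight (capacity G s) D w.
Proof. by move=> [[D0 mw w0] _ w1]; split. Qed.

Lemma bessel_admissible_indic K (c : R) : compact K -> 0 < c ->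
  (capacity G s K <= c%:E)%E ->
  bessel_admissible setT (fun x => (c^-1 * \1_K x)%:E).
Proof.
move=> cK c0 Kc.
have [D0 mw w0 w1] := indic_choquet_weight bessel_capacity_space K c cK c0 Kc.
split => //; split => // K' cK'.
have c0' : 0 <= c^-1 by rewrite invr_ge0 ltW.
have mK'T : measurable (setT `&` K') by rewrite setTI; exact: measurable_compact.
apply: (integral_indic_lty _ _ _ mu K (setT `&` K') c^-1 c0' (measurable_compact K cK) mK'T).
by rewrite setTI; exact: leb_compact_lty.
Qed.

End bessel_capacity_space.

Theorem theorem1p4 (R : realType) (n : nat) (p alpha s : R)
    (G : Rn R n -> R) :
  (1 <= n)%N -> 1 < p -> 0 < alpha -> 1 < s -> alpha * s <= n%:R ->
  bessel_kernel alpha G ->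
  let p' := p / (p - 1) in
  (forall f, Lp_loc p f -> normM G s p f = sup_weighted G s p f) /\
  (forall f g, spaceM G s p f -> spaceN G s p' g ->
    (@leb R n).-integrable setT (EFin \o (fun x => f x * g x))) /\
  isometric_iso_to_dual (spaceN G s p') (normN G s p')
    (spaceM G s p) (normM G s p)
    (fun f1 f2 => {ae @leb R n, forall x, f1 x = f2 x})
    (@pairing R n).
Proof.
move=> _ p1 _ s1 _ GP p'.
have CS := bessel_capacity_space alpha s G s1 GP.
have p0 : 0 < p by exact: lt_trans p1.
have pq : p^-1 + p'^-1 = 1.
  by rewrite /p'; field; rewrite (gt_eqF p0) subr_eq0 (gt_eqF p1).
pose adm := @bessel_admissible R n s G.
have adm_weight := @bessel_admissible_weight R n s G.
have adm_indic := bessel_admissible_indic alpha s G s1 GP.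
split.
  move=> f [mf _]; rewrite -[LHS]/(cap_normM (@leb R n) (capacity G s) compact p f).
  rewrite (cap_normM_sup_weighted CS p f p0 mf); congr (ereal_sup (_ @` _)).
  by apply/seteqP; split => -[D w] /=; [case|case=> -[]].
split.
  exact: (cap_pairing_integrable CS adm p p' p1 pq adm_weight).
split.
- exact: (cap_pairing_dual CS adm p p' p1 pq adm_weight).
- exact: (opnorm_cap_pairing CS adm p p' p1 pq adm_weight adm_indic).
- exact: (cap_pairing_linear CS adm p p' p1 pq adm_weight).
- exact: (cap_pairing_inj CS adm p p' p1 pq adm_weight adm_indic).
- exact: (dual_representation CS adm p p' p1 pq adm_weight adm_indic).
Qed.
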